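(* Let $d\ge 1$, let $f$ be an almost radial decreasing density on $\mathbb{R}^d$, and let $\theta\in\mathbb{S}^{d-1}$ and $\gamma\ge0$ be such that $$\lim_{t\to\infty}\frac{f(t\theta-y)}{f(t\theta)} = e^{\gamma(\theta\cdot y)}\quad\text{for every } y\in\mathbb{R}^d .$$ Then $f\in\mathscr{S}_d(\theta,\gamma)$ if and only if $h(\theta):=\int_{\mathbb{R}^d}e^{\gamma(\theta\cdot y)}f(y)\,dy<\infty$ and $$\lim_{t\to\infty}\frac{f^{n\star}(t\theta-y)}{f(t\theta)} = e^{\gamma(\theta\cdot y)}\, n\, h(\theta)^{n-1}\quad\text{for all } y\in\mathbb{R}^d \text{ and } n\in\mathbb{N}=\{1,2,\dots\}.$$
   Context: A density is a non-negative, non-zero function $f\in L^1(\mathbb{R}^d)$ (with respect to Lebesgue measure; $f$ is a function defined pointwise). $\mathbb{S}^{d-1}$ is the unit sphere of $\mathbb{R}^d$. A function $g$ on $(0,\infty)$ is decreasing if $g(s)\ge g(t)$ whenever $s\le t$ (no strictness required). A density $f$ is almost radial decreasing if there are a decreasing function $g:(0,\infty)\to(0,\infty)$ and a constant $c\ge1$ with $c^{-1}g(|x|)\le f(x)\le c\,g(|x|)$ for all $x\in\mathbb{R}^d\setminus\{0\}$. $f^{n\star}$ is the $n$-fold convolution: $f^{1\star}=f$ and $f^{(n+1)\star}(x)=\int_{\mathbb{R}^d} f^{n\star}(x-y)f(y)\,dy$, defined pointwise with values in $[0,\infty]$. Definition of $\mathscr{S}_d(\theta,\gamma)$: let $f\in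 L^1(\mathbb{R}^d)$, $f\ge0$, with $f(t\theta)>0$ for all $t\ge t_0$, for some $t_0>0$. Then $f\in\mathscr{S}_d(\theta,\gamma)$ if (i) $\lim_{t\to\infty} f(t\theta-y)/f(t\theta)=e^{\gamma(\theta\cdot y)}$ for every $y\in\mathbb{R}^d$, and (ii) $h(\theta):=\int_{\mathbb{R}^d}e^{\gamma(\theta\cdot y)}f(y)\,dy<\infty$ and $\lim_{t\to\infty}f^{2\star}(t\theta)/f(t\theta)=2h(\theta)$. *)

(* Defs.v *)
From HB Require Import structures.
From mathcomp Require Import all_boot all_order all_algebra.
From mathcomp Require Import all_classical all_reals all_analysis.

Set Implicit Arguments.
Unset Strict Implicit.
Unset Printing Implicit Defensive.
Import Order.TTheory GRing.Theory Num.Theory.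
Import numFieldNormedType.Exports.

Local Open Scope classical_set_scope.
Local Open Scope ring_scope.

(* R^d is 'rV[R]_d with the sigma-algebra generated by the coordinates, i.e.
   its Borel sigma-algebra; this is the construction that the library uses for
   tuples. *)
Definition measure_rV_display : measure_display.
Proof. exact: default_measure_display. Qed.

Section measurable_rV.
Context {R : realType} {n : nat}.

Let coors : 'I_n -> 'rV[R]_n -> measurableTypeR R := fun i x => x ord0 i.

Let rV_set0 : g_sigma_preimage coors set0.
Proof. exact: sigma_algebra0. Qed.

Let rV_setC A : g_sigma_preimage coors A -> g_sigma_preimage coors (~` A).
Proof. exact: sigma_algebraC. Qed.

Let rV_bigcup (F : _^nat) : (forall i, g_sigma_preimage coors (F i)) ->
  g_sigma_preimage coors (\bigcup_i (F i)).
Proof. exact: sigma_algebra_bigcup. Qed.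

HB.instance Definition _ := @isMeasurable.Build measure_rV_display
  'rV[R]_n (g_sigma_preimage coors) rV_set0 rV_setC rV_bigcup.

Lemma measurable_coord (i : 'I_n) :
  measurable_fun [set: 'rV[R]_n] (fun x => x ord0 i : measurableTypeR R).
Proof.
move=> _ Y mY; rewrite setTI; apply: sub_sigma_algebra => /=.
rewrite -bigcup_seq/=; exists i => /=; first by rewrite mem_index_enum.
by exists Y => //; rewrite setTI.
Qed.

Lemma measurable_fun_rVP dT (T : measurableType dT) (f : T -> 'rV[R]_n) :
  measurable_fun [set: T] f <->
  forall i, measurable_fun [set: T] (fun t => f t ord0 i : measurableTypeR R).
Proof.
apply: (@iff_trans _ (g_sigma_preimage
    (fun i (t : T) => coors i (f t)) `<=` measurable)).
  rewrite (@g_sigma_preimage_comp _ _ _ _ coors _ f).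
  split=> [mf A [/= C preC <-]|prefS]; first exact: mf.
  by move=> _ A mA; apply: prefS; exists A.
split=> [fS i|mf].
- move=> _ A mA; apply: fS; apply: sub_sigma_algebra.
  rewrite -bigcup_seq/=; exists i => /=; first by rewrite mem_index_enum.
  by exists A.
- apply: smallest_sub; first exact: sigma_algebra_measurable.
  rewrite -bigcup_seq/=; apply: bigcup_sub => i _.
  by move=> A [B mB <-]; exact: mf.
Qed.

End measurable_rV.

Section lebesgue_rV.
Context {R : realType}.

Definition cons_rV n (p : measurableTypeR R * 'rV[R]_n) : 'rV[R]_n.+1 :=
  row_mx (p.1)%:M p.2.

Lemma cons_rV0 n (p : measurableTypeR R * 'rV[R]_n) : cons_rV p ord0 ord0 = p.1.
Proof.
rewrite /cons_rV (_ : ord0 = @lshift 1 n ord0); last exact/val_inj.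
by rewrite (@row_mxEl R 1 1 n) mxE eqxx.
Qed.

Lemma cons_rVS n (p : measurableTypeR R * 'rV[R]_n) (i : 'I_n) :
  cons_rV p ord0 (lift ord0 i) = p.2 ord0 i.
Proof.
rewrite /cons_rV (_ : lift ord0 i = @rshift 1 n i); last exact/val_inj.
by rewrite (@row_mxEr R 1 1 n).
Qed.

Lemma measurable_cons_rV n : measurable_fun setT (@cons_rV n).
Proof.
apply/measurable_fun_rVP => i.
have [j ->|->] := unliftP ord0 i.
  under eq_fun do rewrite cons_rVS.
  exact: (measurableT_comp (measurable_coord j) measurable_snd).
under eq_fun do rewrite cons_rV0.
exact: measurable_fst.
Qed.

Section lebesgue_cons.
Local Open Scope ereal_scope.
Variables (n : nat) (mu : {sigma_finite_measure set 'rV[R]_n -> \bar R}).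

Definition lebesgue_cons : set 'rV[R]_n.+1 -> \bar R :=
  pushforward (@lebesgue_measure R \x mu) (@cons_rV n).

Let lebesgue_cons0 : lebesgue_cons set0 = 0.
Proof. by rewrite /lebesgue_cons /pushforward preimage_set0 measure0. Qed.

Let lebesgue_cons_ge0 A : 0 <= lebesgue_cons A.
Proof. by rewrite /lebesgue_cons /pushforward measure_ge0. Qed.

Let lebesgue_cons_sigma_additive : semi_sigma_additive lebesgue_cons.
Proof.
rewrite /lebesgue_cons => F mF tF mUF.
apply: (@measure_semi_sigma_additive _ _ _
  (pushforward (@lebesgue_measure R \x mu) (@cons_rV n))) => //.
exact: measurable_cons_rV.
Qed.

HB.instance Definition _ := isMeasure.Build _ _ _ lebesgue_cons
  lebesgue_cons0 lebesgue_cons_ge0 lebesgue_cons_sigma_additive.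

Let lebesgue_cons_sigma_finite : sigma_finite setT lebesgue_cons.
Proof.
have /sigma_finiteP[F [TF ndF Foo]] := sigma_finiteT (@lebesgue_measure R).
have /sigma_finiteP[G [TG ndG Goo]] := sigma_finiteT mu.
pose h (x : 'rV[R]_n.+1) : measurableTypeR R * 'rV[R]_n :=
  (x ord0 ord0, (\row_j x ord0 (lift ord0 j))%R).
have mh : measurable_fun setT h.
  apply: measurable_fun_pair; first exact: measurable_coord.
  apply/measurable_fun_rVP => j; under eq_fun do rewrite mxE.
  exact: measurable_coord.
have hK : h \o @cons_rV n = id.
  apply/funext => -[a v]; rewrite /h /= cons_rV0; congr pair.
  by apply/rowP => j; rewrite mxE cons_rVS.
exists (fun k => h @^-1` (F k `*` G k)).
  rewrite -preimage_bigcup -[LHS](preimage_setT h); congr (_ @^-1` _).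
  rewrite -setXTT TF TG predeqE => -[x y]; split.
    move=> [/= [i _ Fix] [k _ Gky]]; exists (maxn i k) => //; split.
    - by move: x Fix; exact/subsetPset/ndF/leq_maxl.
    - by move: y Gky; exact/subsetPset/ndG/leq_maxr.
  by move=> [i _ []/= ? ?]; split; exists i.
move=> k; have [? ?] := Foo k; have [? ?] := Goo k; split.
  by rewrite -[X in measurable X]setTI; apply: mh => //; exact: measurableX.
rewrite /lebesgue_cons /pushforward -comp_preimage hK preimage_id.
by rewrite product_measure1E// lte_mul_pinfty// ge0_fin_numE.
Qed.

HB.instance Definition _ := Measure_isSigmaFinite.Build _ _ _ lebesgue_cons
  lebesgue_cons_sigma_finite.

End lebesgue_cons.

(* Lebesgue measure on R^d, as the d-fold product of lebesgue_measure; the base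
   case is the unit mass on the one-point space R^0. *)
Fixpoint lebesgue_rV (d : nat) : {sigma_finite_measure set 'rV[R]_d -> \bar R} :=
  match d with
  | 0%N => \d_ (0 : 'rV[R]_0)
  | n.+1 => lebesgue_cons (lebesgue_rV n)
  end.

Lemma lebesgue_rV_box (d : nat) (A : 'I_d -> set (measurableTypeR R)) :
  (forall i, measurable (A i)) ->
  (lebesgue_rV d [set x : 'rV[R]_d | forall i, A i (x ord0 i)] =
   \prod_(i < d) lebesgue_measure (A i))%E.
Proof.
elim: d A => [|n IH] A mA.
  rewrite big_ord0 /= diracE mem_set//= => -[]//.
rewrite big_ord_recl /= /lebesgue_cons /pushforward.
rewrite (_ : _ @^-1` _ = A ord0 `*`
  [set x : 'rV[R]_n | forall i, A (lift ord0 i) (x ord0 i)]); last first.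
  apply/seteqP; split => -[a v] /= H.
    split; first by have := H ord0; rewrite cons_rV0.
    by move=> i; have := H (lift ord0 i); rewrite cons_rVS.
  move=> i; have [j ->|->] := unliftP ord0 i; first by rewrite cons_rVS; apply H.2.
  by rewrite cons_rV0; apply H.1.
rewrite product_measure1E//; first by congr (_ * _)%E; exact: IH.
rewrite (_ : [set _ | _] = \bigcap_(i in [set` xpredT])
  [set x : 'rV[R]_n | A (lift ord0 i) (x ord0 i)]).
  apply: fin_bigcap_measurable => // i _.
  rewrite -[X in measurable X]setTI.
  by apply: (measurable_coord i).
by apply/seteqP; split => x /= H i; [move=> _; exact: H|exact: (H i isT)].
Qed.

End lebesgue_rV.
Arguments lebesgue_rV {R} d.

Section densities.
Context {R : realType} {d : nat}.
Implicit Types (f : 'rV[R]_d -> R) (x y theta : 'rV[R]_d) (gamma : R).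

Definition dot x y : R := \sum_(i < d) x ord0 i * y ord0 i.

(* the norm that the library puts on 'rV[R]_d is the sup norm *)
Definition enorm x : R := Num.sqrt (dot x x).

Definition sphere : set 'rV[R]_d := [set x | enorm x = 1].

(* [f] is a pointwise-defined representative of an element of L^1(R^d): it is
   Lebesgue measurable, i.e. almost everywhere equal to a Borel function, and
   integrable. The library's [integrable] asks for Borel measurability. *)
Definition in_L1 f : Prop :=
  exists2 f0 : 'rV[R]_d -> R,
    (lebesgue_rV d).-integrable setT (EFin \o f0) &
    f = f0 %[ae lebesgue_rV d].

(* "non-zero" is meant in L^1(R^d) *)
Definition density f : Prop :=
  [/\ in_L1 f, forall x, 0 <= f x & ~ (f = cst 0 %[ae lebesgue_rV d])].

Definition almost_radial_decreasing f : Prop :=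
  exists (g : R -> R) (c : R),
    [/\ forall s, 0 < s -> 0 < g s,
        forall s t, 0 < s -> s <= t -> g t <= g s,
        1 <= c &
        forall x, x != 0 ->
          c^-1 * g (enorm x) <= f x /\ f x <= c * g (enorm x)].

(* [conv_succ f k] is the (k+1)-fold convolution of f *)
Fixpoint conv_succ f (k : nat) : 'rV[R]_d -> \bar R :=
  match k with
  | 0%N => fun x => (f x)%:E
  | k'.+1 => fun x => (\int[lebesgue_rV d]_y
      (conv_succ f k' (x - y) * (f y)%:E))%E
  end.

(* f^{n*}, for n >= 1; the value at n = 0 is junk *)
Definition conv_pow f (n : nat) : 'rV[R]_d -> \bar R := conv_succ f n.-1.

Definition hfun f theta gamma : \bar R :=
  (\int[lebesgue_rV d]_y (expR (gamma * dot theta y) * f y)%:E)%E.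

Definition directional_limit f theta gamma : Prop :=
  forall y, f (t *: theta - y) / f (t *: theta) @[t --> +oo]
    --> expR (gamma * dot theta y).

Definition classS theta gamma f : Prop :=
  [/\ in_L1 f,
      forall x, 0 <= f x,
      exists2 t0 : R, 0 < t0 & forall t, t0 <= t -> 0 < f (t *: theta),
      directional_limit f theta gamma &
      (hfun f theta gamma < +oo)%E /\
      (conv_pow f 2 (t *: theta) / (f (t *: theta))%:E)%E @[t --> +oo]
        --> (2%:E * hfun f theta gamma)%E].

End densities.

(* Main.v *)
Require Import Defs.
From HB Require Import structures.
From mathcomp Require Import all_boot all_order all_algebra.
From mathcomp Require Import all_classical all_reals all_analysis.
From mathcomp Require Import measurable_realfun.
From mathcomp Require Import ring lra.

(* Write x = t theta. In f^{2*}(x) = int f(x - y) f(y) dy, the map y |-> x - y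
   sends the complement of the half-space {theta.y <= t/2 + b} to a half-space of
   the same kind, and Fatou's lemma bounds the liminf of the contribution of each
   of the two, divided by f(x), from below by h. Since f is in S, the total tends
   to 2h, hence each half contributes exactly h in the limit; this turns f(x - y) f(y) / f(x),
   restricted to a half-space, into an admissible dominating sequence.
   The limits of f^{n*}(x - z) / f(x) follow by induction on n: split the
   integral of f^{n*}(x - z - y) f(y) along the hyperplane and use dominated
   convergence on each half, with limits n h^{n-1} h and h^n (times e^{gamma
   theta.z}). The domination requires f^{n*} <= C f at infinity. In the direction
   theta this is the induction hypothesis, and almost radiality of f together with
   the invariance of Lebesgue measure under reflections extends it to all
   directions. *)

Set Implicit Arguments.
Unset Strict Implicit.
Unset Printing Implicit Defensive.
Import Order.TTheory GRing.Theory Num.Theory.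
Import numFieldNormedType.Exports.

Local Open Scope classical_set_scope.
Local Open Scope ring_scope.

(** * Invariance of Lebesgue measure on R^d *)

Section measure_preserving.
Context dT (T : measurableType dT) (R : realType).
Local Open Scope ereal_scope.

Lemma ge0_integral_invariant (mu : {measure set T -> \bar R}) (phi : T -> T)
    (f : T -> \bar R) :
  measurable_fun setT phi ->
  (forall A, measurable A -> mu (phi @^-1` A) = mu A) ->
  measurable_fun setT f -> (forall x, 0 <= f x) ->
  \int[mu]_x f (phi x) = \int[mu]_x f x.
Proof.
move=> mphi muphi mf f0.
rewrite -[LHS]/(\int[mu]_(x in phi @^-1` setT) (f \o phi) x).
rewrite -ge0_integral_pushforward//.
by apply: eq_measure_integral => A mA _; exact: muphi.
Qed.

Lemma ae_comp_invariant (mu : {measure set T -> \bar R}) (phi : T -> T)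
    (P : T -> Prop) :
  measurable_fun setT phi ->
  (forall A, measurable A -> mu (phi @^-1` A) = mu A) ->
  {ae mu, forall x, P x} -> {ae mu, forall x, P (phi x)}.
Proof.
move=> mphi muphi [N [mN N0 PN]]; exists (phi @^-1` N); split.
- by rewrite -[X in measurable X]setTI; exact: mphi.
- by rewrite muphi.
- by move=> x /= Px; exact: PN.
Qed.

Import HBNNSimple.

(* The integral of a function that is not measurable is by definition the
   supremum of the integrals of the simple functions below it; these may be
   truncated to [0] on a null set. *)
Lemma ge0_ae_eq_integral_nonmeasurable (mu : {measure set T -> \bar R})
    (f f0 : T -> \bar R) :
  measurable_fun setT f0 -> (forall x, 0 <= f0 x) -> (forall x, 0 <= f x) ->
  f = f0 %[ae mu] -> \int[mu]_x f x = \int[mu]_x f0 x.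
Proof.
move=> mf0 f00 f_0 [N [mN N0 ff0N]].
have ff0 x : ~ N x -> f x = f0 x.
  by move=> Nx; apply: contrapT => fx; apply/Nx/ff0N => /= /(_ I).
pose fN := f0 \_ (~` N).
have mfN : measurable_fun setT fN.
  by apply/(measurable_restrictT _ _).1 => //; [exact: measurableC|
    exact: measurable_funS mf0].
have fN0 x : 0 <= fN x by rewrite /fN patchE; case: ifP.
have fNE : \int[mu]_x fN x = \int[mu]_x f0 x.
  apply: ge0_ae_eq_integral => //; exists N; split => // x /= Hx.
  apply: contrapT => Nx; apply: Hx => _.
  by rewrite /fN patchE mem_set.
apply/eqP; rewrite eq_le; apply/andP; split; last first.
  rewrite -fNE ge0_integralTE// ge0_integralTE//.
  apply: ereal_sup_le => _ [h /= hf <-]; exists h => // x.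
  apply: (le_trans (hf x)); rewrite /fN patchE.
  by case: ifPn => //; rewrite inE => Nx; rewrite ff0.
rewrite [leLHS]ge0_integralTE//; apply: ge_ereal_sup => _ [h /= hf <-].
rewrite -integralT_nnsfun.
have -> : \int[mu]_x (h x)%:E = \int[mu]_x ((EFin \o h) \_ (~` N)) x.
  apply: ge0_ae_eq_integral => //.
  - exact/measurable_EFinP.
  - apply/(measurable_restrictT _ _).1; first exact: measurableC.
    by apply: (@measurable_funS _ _ _ _ setT) => //; exact/measurable_EFinP.
  - by move=> x _; rewrite lee_fin.
  - by move=> x _; rewrite patchE; case: ifP => // _; rewrite /= lee_fin.
  - exists N; split => // x /= Hx; apply: contrapT => Nx; apply: Hx => _.
    by rewrite patchE mem_set.
apply: ge0_le_integral => //.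
- by move=> x _; rewrite patchE; case: ifP => // _; rewrite /= lee_fin.
- apply/(measurable_restrictT _ _).1; first exact: measurableC.
  by apply: (@measurable_funS _ _ _ _ setT) => //; exact/measurable_EFinP.
- move=> x _; rewrite patchE; case: ifPn => //; rewrite inE => Nx.
  by rewrite -ff0//; exact: hf.
Qed.

End measure_preserving.

Section translations.
Context {R : realType}.

Lemma measurable_funB_rV dT (T : measurableType dT) n (f g : T -> 'rV[R]_n) :
  measurable_fun setT f -> measurable_fun setT g ->
  measurable_fun setT (fun t => f t - g t).
Proof.
move=> /measurable_fun_rVP mf /measurable_fun_rVP mg.
apply/measurable_fun_rVP => i; under eq_fun do rewrite !mxE.
exact: measurable_funB (mf i) (mg i).
Qed.

Lemma measurable_funD_rV dT (T : measurableType dT) n (f g : T -> 'rV[R]_n) :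
  measurable_fun setT f -> measurable_fun setT g ->
  measurable_fun setT (fun t => f t + g t).
Proof.
move=> /measurable_fun_rVP mf /measurable_fun_rVP mg.
apply/measurable_fun_rVP => i; under eq_fun do rewrite !mxE.
exact: measurable_funD (mf i) (mg i).
Qed.

Lemma measurable_oppr_rV n : measurable_fun setT (fun y : 'rV[R]_n => - y).
Proof.
have := measurable_funB_rV (measurable_cst (0 : 'rV[R]_n)) (@measurable_id _ _ setT).
by under eq_fun do rewrite sub0r.
Qed.

Lemma measurable_subl_rV n (x : 'rV[R]_n) : measurable_fun setT (fun y : 'rV[R]_n => x - y).
Proof. exact: measurable_funB_rV (measurable_cst _) (@measurable_id _ _ _). Qed.

Lemma measurable_subr_rV n (x : 'rV[R]_n) : measurable_fun setT (fun y : 'rV[R]_n => y - x).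
Proof. exact: measurable_funB_rV (@measurable_id _ _ _) (measurable_cst _). Qed.

(** The image of Lebesgue measure under a translation has the same values on half-open intervals,
    and these determine it. *)
Lemma lebesgue_measureB (a : R) (A : set (measurableTypeR R)) :
  measurable A -> lebesgue_measure [set x | A (x - a)] = lebesgue_measure A.
Proof.
move=> mA.
pose phi : measurableTypeR R -> measurableTypeR R := fun x => x - a.
have mphi : measurable_fun setT phi.
  by apply: measurable_funB => //; exact: measurable_id.
apply/esym.
apply: (lebesgue_measure_unique (mu := pushforward lebesgue_measure phi)) => //.
move=> _ [[b c]] _ <-; rewrite [RHS]/(lebesgue_measure (phi @^-1` `]b, c])).
rewrite (_ : phi @^-1` `]b, c] = `]b + a, c + a]%classic); last first.
  by apply/seteqP; split => x /=; rewrite !in_itv /= /phi ltrBrDr lerBlDr.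
rewrite [LHS]lebesgue_measure_itv [RHS]lebesgue_measure_itv/=.
by rewrite !lte_fin ltrD2r -!EFinB opprD addrACA subrr addr0.
Qed.

Definition translation_invariant n (nu : set 'rV[R]_n -> \bar R) :=
  forall (a : 'rV[R]_n) A, measurable A -> nu [set x | A (x - a)] = nu A.

(** Induction on the dimension: a translation acts on the first coordinate and on the rest
    separately, so it preserves the measure of rectangles, and uniqueness of the product measure
    extends this to all measurable sets. *)
Lemma lebesgue_rV_translation n : translation_invariant (@lebesgue_rV R n).
Proof.
elim: n => [|n IH] a A mA.
  by congr (lebesgue_rV _ _); apply/seteqP; split => x /=; rewrite (thinmx0 a) subr0.
rewrite /= /lebesgue_cons /pushforward.
pose phi (p : measurableTypeR R * 'rV[R]_n) : measurableTypeR R * 'rV[R]_n :=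
  (p.1 - a ord0 ord0, p.2 - \row_j a ord0 (lift ord0 j)).
have mphi : measurable_fun setT phi.
  apply: measurable_fun_pair.
    by apply: measurable_funB => //; exact: measurable_fst.
  exact: measurable_funB_rV (@measurable_snd _ _ _ _) (measurable_cst _).
rewrite (_ : _ @^-1` [set x | A (x - a)] = phi @^-1` (@cons_rV _ n @^-1` A)); last first.
  suff cE p : cons_rV p - a = cons_rV (phi p).
    by apply/seteqP; split => p /=; rewrite cE.
  apply/rowP => i; rewrite mxE [X in _ + X]mxE.
  have [j ->|->] := unliftP ord0 i; first by rewrite !cons_rVS !mxE.
  by rewrite !cons_rV0.
apply/esym; apply: (@product_measure_unique _ _ _ _ _ _ _
  (pushforward (lebesgue_measure \x lebesgue_rV n)%E phi)) => //; last first.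
  by rewrite -[X in measurable X]setTI; exact: measurable_cons_rV.
move=> B C mB mC.
rewrite [LHS]/((lebesgue_measure \x lebesgue_rV n)%E
  ([set x | B (x - a ord0 ord0)] `*` [set x | C (x - \row_j a ord0 (lift ord0 j))])).
apply: (etrans (product_measure1E _ _ _ _)).
- rewrite -[X in measurable X]setTI.
  by apply: (measurable_funB (@measurable_id _ _ _) (measurable_cst _)).
- by rewrite -[X in measurable X]setTI; exact: measurable_subr_rV.
by congr (_ * _)%E; [exact: lebesgue_measureB|exact: IH].
Qed.

Section uniqueness.
Variable n : nat.
Implicit Types mu nu : {sigma_finite_measure set 'rV[R]_n -> \bar R}.
Local Open Scope ereal_scope.

Lemma integral_translation nu (nut : translation_invariant nu) (a : 'rV[R]_n)
    (f : 'rV[R]_n -> \bar R) :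
  measurable_fun setT f -> (forall x, 0 <= f x) ->
  \int[nu]_x f (x + a)%R = \int[nu]_x f x.
Proof.
rewrite -[a]opprK.
by apply: ge0_integral_invariant; [exact: measurable_subr_rV|exact: nut].
Qed.

(* Tonelli applied to [f (x + y) * g y]. *)
Lemma translation_invariant_exchange mu nu (f g : 'rV[R]_n -> \bar R) :
  translation_invariant mu -> translation_invariant nu ->
  measurable_fun setT f -> measurable_fun setT g ->
  (forall x, 0 <= f x) -> (forall x, 0 <= g x) ->
  \int[mu]_x f x * \int[nu]_x g x = \int[nu]_x f x * \int[mu]_x g (- x)%R.
Proof.
move=> mut nut mf mg f0 g0.
have m1 : measurable_fun setT (fun p : 'rV[R]_n * 'rV[R]_n => (p.1 + p.2)%R).
  exact: measurable_funD_rV measurable_fst measurable_snd.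
transitivity (\int[mu]_x \int[nu]_y (f (x + y)%R * g y)).
  rewrite (@fubini_tonelli _ _ _ _ _ mu nu (fun p => f (p.1 + p.2)%R * g p.2)); last 2 first.
  - apply: emeasurable_funM; first exact: measurableT_comp mf m1.
    exact: measurableT_comp mg (@measurable_snd _ _ _ _).
  - by move=> p; exact: mule_ge0.
  rewrite -ge0_integralZl//; last by exact: integral_ge0.
  apply: eq_integral => y _ /=.
  rewrite (ge0_integralZr _ _ _ (k := g y))//; last first.
    apply: measurableT_comp mf _.
    exact: measurable_funD_rV (@measurable_id _ _ _) (measurable_cst _).
  by rewrite (integral_translation mut).
transitivity (\int[mu]_x \int[nu]_y (f y * g (y - x)%R)).
  apply: eq_integral => x _.
  have := @integral_translation _ nut x (fun y => f y * g (y - x)%R).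
  move=> <-; last 2 first.
  - apply: emeasurable_funM => //.
    by apply: measurableT_comp mg _; exact: measurable_subr_rV.
  - by move=> y; exact: mule_ge0.
  by apply: eq_integral => y _; rewrite addrK addrC.
rewrite (@fubini_tonelli _ _ _ _ _ mu nu (fun p => f p.2 * g (p.2 - p.1)%R)); last 2 first.
- apply: emeasurable_funM; first exact: measurableT_comp mf (@measurable_snd _ _ _ _).
  apply: measurableT_comp mg _.
  exact: measurable_funB_rV (@measurable_snd _ _ _ _) (@measurable_fst _ _ _ _).
- by move=> p; exact: mule_ge0.
rewrite -ge0_integralZr//; last by exact: integral_ge0.
apply: eq_integral => y _ /=; rewrite ge0_integralZl//; last first.
  by apply: measurableT_comp mg _; exact: measurable_subl_rV.
congr (_ * _).
have := @integral_translation _ mut (- y)%R (fun x => g (- x)%R) => <- //; last first.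
  exact: measurableT_comp mg (@measurable_oppr_rV _).
by apply: eq_integral => x _; rewrite opprB.
Qed.

End uniqueness.

End translations.

Section invariance.
Context {R : realType} {n : nat}.
Local Open Scope ereal_scope.

(** Taking for [mu] Lebesgue measure and for [A] the unit box, this expresses [nu B] as the constant
    [nu A] times the Lebesgue measure of [- B]: translation-invariant measures are unique up to
    scaling. *)
Lemma translation_invariant_exchange_set
    (mu nu : {sigma_finite_measure set 'rV[R]_n -> \bar R}) A B :
  translation_invariant mu -> translation_invariant nu ->
  measurable A -> measurable B ->
  mu A * nu B = nu A * mu [set x | B (- x)%R].
Proof.
move=> mut nut mA mB.
have mB' : measurable [set x | B (- x)%R].
  by rewrite -[X in measurable X]setTI; exact: measurable_oppr_rV.
have := translation_invariant_exchange (f := EFin \o \1_A) (g := EFin \o \1_B)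
  mut nut.
rewrite /= -[X in _ -> _ -> _ -> _ -> _ = _ * X]/(\int[mu]_x (\1_[set x | B (- x)%R] x)%:E).
rewrite !integral_indic ?setIT//; apply.
- by apply/measurable_EFinP; exact: measurable_indic.
- by apply/measurable_EFinP; exact: measurable_indic.
- by move=> x; rewrite lee_fin.
- by move=> x; rewrite lee_fin.
Qed.

Definition unit_box : set 'rV[R]_n := [set x | forall i, `[0%R, 1%R]%classic (x ord0 i)].

Lemma measurable_unit_box : measurable unit_box.
Proof.
rewrite (_ : unit_box = \bigcap_(i in [set` xpredT])
  [set x : 'rV[R]_n | `[0%R, 1%R]%classic (x ord0 i)]); last first.
  by apply/seteqP; split => x /= H i; [move=> _; exact: H|exact: (H i isT)].
apply: fin_bigcap_measurable => // i _.
rewrite -[X in measurable X]setTI.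
by apply: (measurable_coord i).
Qed.

Lemma lebesgue_rV_unit_box : lebesgue_rV n unit_box = 1.
Proof.
rewrite (lebesgue_rV_box (A := fun=> `[0%R, 1%R]%classic))// big1// => i _.
by rewrite lebesgue_measure_itv/= lte_fin ltr01 -EFinB subr0.
Qed.

Lemma lebesgue_rVN (B : set 'rV[R]_n) : measurable B ->
  lebesgue_rV n [set x | B (- x)%R] = lebesgue_rV n B.
Proof.
move=> mB.
have := translation_invariant_exchange_set (@lebesgue_rV_translation R n)
  (@lebesgue_rV_translation R n) measurable_unit_box mB.
by rewrite lebesgue_rV_unit_box !mul1e.
Qed.

(** The map [x |-> a - x] exchanges the two arguments in a convolution evaluated at [a]; it is a
    negation followed by a translation. *)
Lemma lebesgue_rV_subl (a : 'rV[R]_n) (A : set 'rV[R]_n) : measurable A ->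
  lebesgue_rV n [set x | A (a - x)%R] = lebesgue_rV n A.
Proof.
move=> mA.
have mA' : measurable [set x : 'rV[R]_n | A (- x)%R].
  by rewrite -[X in measurable X]setTI; exact: measurable_oppr_rV.
rewrite -[RHS]lebesgue_rVN//.
apply: etrans (lebesgue_rV_translation a mA').
by congr (lebesgue_rV n _); apply/seteqP; split => x /=; rewrite opprB.
Qed.

(* By uniqueness the image measure is a multiple of Lebesgue measure; applying
   the involution twice shows that the factor is 1. *)
Section linear_involution.
Variables (S : 'rV[R]_n -> 'rV[R]_n).
Hypothesis mS : measurable_fun setT S.
Hypothesis SK : involutive S.
Hypothesis SB : {morph S : x y / (x - y)%R}.

Let nu : set 'rV[R]_n -> \bar R := pushforward (lebesgue_rV n) S.

Let nu0 : nu set0 = 0.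
Proof. by rewrite /nu /pushforward preimage_set0 measure0. Qed.

Let nu_ge0 A : 0 <= nu A.
Proof. by rewrite /nu /pushforward measure_ge0. Qed.

Let nu_sigma_additive : semi_sigma_additive nu.
Proof.
move=> F mF tF mUF.
exact: (@measure_semi_sigma_additive _ _ _ (pushforward (lebesgue_rV n) S)).
Qed.

HB.instance Definition _ := isMeasure.Build _ _ _ nu
  nu0 nu_ge0 nu_sigma_additive.

Let nu_sigma_finite : sigma_finite setT nu.
Proof.
have /sigma_finiteP[F [TF ndF Foo]] := sigma_finiteT (@lebesgue_rV R n).
(* Since [S \o S] is the identity, the [nu]-measure of the preimage of [F k] is the Lebesgue measure
   of [F k]. *)
exists (fun k => S @^-1` F k).
  by rewrite -preimage_bigcup -TF preimage_setT.
move=> k; have [mF Fk] := Foo k; split.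
  by rewrite -[X in measurable X]setTI; exact: mS.
rewrite /nu /pushforward -comp_preimage.
by rewrite (_ : S \o S = id) ?preimage_id//; exact/funext.
Qed.

HB.instance Definition _ := Measure_isSigmaFinite.Build _ _ _ nu
  nu_sigma_finite.

Lemma lebesgue_rV_involution (A : set 'rV[R]_n) : measurable A ->
  lebesgue_rV n (S @^-1` A) = lebesgue_rV n A.
Proof.
have mSA B : measurable B -> measurable (S @^-1` B).
  by move=> mB; rewrite -[X in measurable X]setTI; exact: mS.
have nut : translation_invariant nu.
  move=> a B mB; rewrite /nu /pushforward.
  apply: etrans (lebesgue_rV_translation (S a) (mSA _ mB)).
  by congr (lebesgue_rV n _); apply/seteqP; split => x /=; rewrite SB SK.
have nuE B : measurable B -> nu B = nu unit_box * lebesgue_rV n B.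
  move=> mB; rewrite -[in RHS](lebesgue_rVN mB).
  rewrite -(translation_invariant_exchange_set (@lebesgue_rV_translation R n)
    nut measurable_unit_box mB).
  by rewrite lebesgue_rV_unit_box mul1e.
move=> mA; rewrite -[LHS]/(nu A) nuE//.
suff -> : nu unit_box = 1 by rewrite mul1e.
(* With c the [nu]-measure of the box, this instance reads 1 = c * c, and c is nonnegative. *)
have := nuE _ (mSA _ measurable_unit_box).
rewrite -[X in _ * X]/(nu unit_box).
rewrite {1}/nu /pushforward -comp_preimage.
rewrite (_ : S \o S = id) ?preimage_id; last exact/funext.
rewrite lebesgue_rV_unit_box.
have := nu_ge0 unit_box; case: (nu unit_box) => [r| |]//.
rewrite lee_fin -EFinM => r0 [] /esym/eqP.
by rewrite -expr2 sqrp_eq1// => /eqP ->.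
Qed.

End linear_involution.

End invariance.

(** * Euclidean geometry *)

Section euclidean.
Context {R : realType} {d : nat}.
Implicit Types (x y z : 'rV[R]_d) (a : R).

Lemma dotC x y : dot x y = dot y x.
Proof. by apply: eq_bigr => i _; rewrite mulrC. Qed.

Lemma dotDr x y z : dot x (y + z) = dot x y + dot x z.
Proof. by rewrite -big_split; apply: eq_bigr => i _; rewrite mxE mulrDr. Qed.

Lemma dotZr a x y : dot x (a *: y) = a * dot x y.
Proof. by rewrite mulr_sumr; apply: eq_bigr => i _; rewrite mxE mulrCA. Qed.

Lemma dotNr x y : dot x (- y) = - dot x y.
Proof. by rewrite -scaleN1r dotZr mulN1r. Qed.

Lemma dotBr x y z : dot x (y - z) = dot x y - dot x z.
Proof. by rewrite dotDr dotNr. Qed.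

Lemma dotBl x y z : dot (x - y) z = dot x z - dot y z.
Proof. by rewrite dotC dotBr !(dotC z). Qed.

Lemma dotZl a x y : dot (a *: x) y = a * dot x y.
Proof. by rewrite dotC dotZr dotC. Qed.

Lemma dot0r x : dot x 0 = 0.
Proof. by rewrite -(scale0r x) dotZr mul0r. Qed.

Lemma dotxx_ge0 x : 0 <= dot x x.
Proof. by apply: sumr_ge0 => i _; rewrite -expr2 sqr_ge0. Qed.

Lemma dotxx_eq0 x : (dot x x == 0) = (x == 0).
Proof.
apply/idP/eqP => [|->]; last by rewrite dot0r.
rewrite psumr_eq0 => [/allP x0|i _]; last by rewrite -expr2 sqr_ge0.
apply/rowP => i; rewrite mxE; apply/eqP.
by have := x0 i; rewrite mem_index_enum mulf_eq0 orbb => /(_ isT).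
Qed.

Lemma enorm_ge0 x : 0 <= enorm x.
Proof. exact: sqrtr_ge0. Qed.

Lemma enorm_sqr x : enorm x ^+ 2 = dot x x.
Proof. by rewrite sqr_sqrtr// dotxx_ge0. Qed.

Lemma enorm_gt0 x : (0 < enorm x) = (x != 0).
Proof. by rewrite sqrtr_gt0 lt0r dotxx_ge0 andbT dotxx_eq0. Qed.

Lemma enormZ a x : enorm (a *: x) = `|a| * enorm x.
Proof.
by rewrite /enorm dotZl dotZr mulrA -expr2 sqrtrM ?sqr_ge0// sqrtr_sqr.
Qed.

Lemma dot_le_enorm x y : dot x y <= enorm x * enorm y.
Proof.
have [->|y0] := eqVneq y 0; first by rewrite dot0r mulr_ge0// enorm_ge0.
have y20 : 0 < dot y y by rewrite lt0r dotxx_eq0 y0 dotxx_ge0.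
have xy2 : dot x y ^+ 2 <= dot x x * dot y y.
  (* Up to the factor |y|^2, this vector is the component of x orthogonal to y; its squared norm is
     |y|^2 times the Cauchy-Schwarz defect. *)
  have := dotxx_ge0 (dot y y *: x - dot x y *: y).
  rewrite !(dotBl, dotBr, dotZl, dotZr) (dotC y x) [X in 0 <= X](_ : _ =
    dot y y * (dot x x * dot y y - dot x y ^+ 2)); last by rewrite expr2; ring.
  by rewrite pmulr_rge0// subr_ge0.
rewrite (le_trans (ler_norm _))// -(@ler_pXn2r _ 2) ?nnegrE ?mulr_ge0 ?enorm_ge0//.
by rewrite real_normK ?num_real// exprMn !enorm_sqr.
Qed.

Lemma ler_enormB x y : enorm x - enorm y <= enorm (x - y).
Proof.
have [xy|/ltW xy] := leP (enorm x - enorm y) 0.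
  exact: le_trans xy (enorm_ge0 _).
rewrite -(@ler_pXn2r _ 2) ?nnegrE ?enorm_ge0// sqrrB !enorm_sqr dotBl !dotBr.
have := dot_le_enorm x y; rewrite (dotC y x); lra.
Qed.

Lemma measurable_dot x : measurable_fun setT (dot x : 'rV[R]_d -> R).
Proof.
apply: measurable_sum => i; apply: measurable_funM; first exact: measurable_cst.
exact: measurable_coord.
Qed.

Lemma measurable_enorm : measurable_fun setT (enorm : 'rV[R]_d -> R).
Proof.
have msqrt : measurable_fun setT (Num.sqrt : R -> R).
  by apply: continuous_measurable_fun; exact: sqrt_continuous.
apply: (measurableT_comp (g := fun x : 'rV[R]_d => dot x x) msqrt).
by apply: measurable_sum => i; apply: measurable_funM;
  [exact: measurable_coord|exact: measurable_coord].
Qed.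

(* For [x = y] the division by zero makes this the identity. *)
Definition reflection x y : 'rV[R]_d -> 'rV[R]_d := fun z =>
  z - (2 * dot (x - y) z / dot (x - y) (x - y)) *: (x - y).

Section reflection.
Variables x y : 'rV[R]_d.

Lemma reflectionB : {morph reflection x y : z t / z - t}.
Proof.
move=> z t; rewrite /reflection dotBr mulrBr mulrBl scalerBl.
by rewrite !opprB addrACA [RHS]addrACA [- t - _]addrC.
Qed.

Lemma reflectionK : involutive (reflection x y).
Proof.
move=> z; rewrite /reflection; move: (x - y) => v; set k := _ / _.
suff -> : 2 * dot v (z - k *: v) / dot v v = - k by rewrite scaleNr opprK subrK.
have [v0|v0] := eqVneq (dot v v) 0; first by rewrite /k v0 invr0 !mulr0 oppr0.
by rewrite dotBr dotZr /k; field.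
Qed.

Lemma enorm_reflection z : enorm (reflection x y z) = enorm z.
Proof.
rewrite /enorm /reflection; move: (x - y) => v; set k := _ / _; congr Num.sqrt.
rewrite !(dotBl, dotBr, dotZl, dotZr) (dotC z v).
have [v0|v0] := eqVneq (dot v v) 0; first by rewrite /k v0 invr0 !mulr0; ring.
by rewrite /k; field.
Qed.

Lemma reflection_swap : enorm x = enorm y -> reflection x y x = y.
Proof.
move=> xy; rewrite /reflection; set v := x - y.
have [v0|v0] := eqVneq v 0.
  by rewrite v0 scaler0 subr0; apply/eqP; rewrite -subr_eq0 -/v v0.
have vv0 : dot v v != 0 by rewrite dotxx_eq0.
(* As |x| = |y|, both 2 v.x and v.v equal 2 (|x|^2 - x.y). *)
suff -> : 2 * dot v x / dot v v = 1 by rewrite scale1r opprB addrC subrK.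
have xxyy : dot x x = dot y y by rewrite -!enorm_sqr xy.
apply: (mulIf vv0); rewrite divfK// mul1r /v !(dotBl, dotBr) (dotC y x) xxyy.
by ring.
Qed.

Lemma measurable_reflection : measurable_fun setT (reflection x y).
Proof.
apply: measurable_funB_rV; first exact: measurable_id.
apply/measurable_fun_rVP => i; under eq_fun do rewrite mxE.
apply: measurable_funM; last exact: measurable_cst.
apply: measurable_funM; last exact: measurable_cst.
apply: measurable_funM; first exact: measurable_cst.
exact: measurable_dot.
Qed.

End reflection.

Lemma lebesgue_rV_reflection x y (A : set 'rV[R]_d) : measurable A ->
  lebesgue_rV d (reflection x y @^-1` A) = lebesgue_rV d A.
Proof.
apply: lebesgue_rV_involution;
  [exact: measurable_reflection|exact: reflectionK|exact: reflectionB].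
Qed.

End euclidean.

(** * Passing to the limit under the integral *)

Section limits_of_integrals.
Context {R : realType}.
Local Open Scope ereal_scope.

(** The liminf of [b] is at least [B], so [a], being the sum minus [b], has limsup at most [A]; its
    liminf is at least [A] by assumption. *)
Lemma cvge_summand (a b : nat -> \bar R) (A B : R) :
  (forall e : R, (0 < e)%R -> \forall k \near \oo, (A - e)%:E < a k) ->
  (forall e : R, (0 < e)%R -> \forall k \near \oo, (B - e)%:E < b k) ->
  a k + b k @[k --> \oo] --> (A + B)%:E -> a k @[k --> \oo] --> A%:E.
Proof.
move=> aA bB /fine_cvgP[abfin /cvgrPdist_lt abAB].
have afin : \forall k \near \oo, a k \is a fin_num.
  near=> k; have : a k + b k \is a fin_num by near: k.
  by rewrite fin_numD => /andP[].
apply/fine_cvgP; split => //; apply/cvgrPdist_lt => e e0; near=> k => /=.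
have ak : (A - e / 2)%:E < a k by near: k; apply: aA; rewrite divr_gt0.
have bk : (B - e / 2)%:E < b k by near: k; apply: bB; rewrite divr_gt0.
have abk : (`|A + B - fine (a k + b k)| < e / 2)%R.
  by near: k; apply: abAB; rewrite divr_gt0.
have : a k + b k \is a fin_num by near: k.
move: ak bk abk; rewrite fin_numD => + + + /andP[].
case: (a k) => // r; case: (b k) => // s; rewrite !lte_fin -EFinD /= => rA sB.
by rewrite !ltr_norml => /andP[rs1 rs2] _ _; apply/andP; split; lra.
Unshelve. all: by end_near. Qed.

Context dT (T : measurableType dT) (mu : {measure set T -> \bar R}).

(** Fatou's lemma as an eventual strict lower bound, the form that [cvge_summand] takes as input. *)
Lemma fatou_near (v : nat -> T -> R) (v0 : T -> R) (A : R) :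
  (forall k, measurable_fun setT (v k)) -> measurable_fun setT v0 ->
  (forall k x, 0 <= v k x)%R -> (forall x, 0 <= v0 x)%R ->
  {ae mu, forall x, v k x @[k --> \oo] --> v0 x} ->
  \int[mu]_x (v0 x)%:E = A%:E ->
  forall e : R, (0 < e)%R -> \forall k \near \oo, (A - e)%:E < \int[mu]_x (v k x)%:E.
Proof.
move=> mv mv0 vge0 v0ge0 vv0 v0A e e0.
have liminfE : \int[mu]_x limn_einf (fun k => (v k x)%:E) = A%:E.
  rewrite -v0A; apply: ge0_ae_eq_integral_nonmeasurable.
  - exact/measurable_EFinP.
  - by move=> x; rewrite lee_fin.
  - move=> x; rewrite limn_einf_lim; apply: lime_ge; first exact: is_cvg_einfs.
    by apply: nearW => k; apply: le_ereal_inf_tmp => _ [m _ <-]; rewrite lee_fin.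
  - apply: filterS vv0 => x vx _.
    suff : (v k x)%:E @[k --> \oo] --> (v0 x)%:E by move=> /cvg_limn_einf_sup[].
    by apply/fine_cvgP; split => //; exact: nearW.
have : A%:E <= limn_einf (fun k => \int[mu]_x (v k x)%:E).
  rewrite -liminfE; apply: fatou => //.
  - by move=> k; exact/measurable_EFinP.
  - by move=> k x _; rewrite lee_fin.
rewrite limn_einf_lim (cvg_lim _ (@cvg_einfs_sup _ _))// => Asup.
have : (A - e)%:E < ereal_sup (range (einfs (fun k => \int[mu]_x (v k x)%:E))).
  by apply: lt_le_trans Asup; rewrite lte_fin ltrBlDr ltrDl.
move=> /ereal_sup_gt[_ [N _ <-] AN]; exists N => // k /= Nk.
by apply: (lt_le_trans AN); apply: ereal_inf_lbound; exists k.
Qed.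

(* Fatou's lemma applied to both [v k] and [u k - v k]. *)
Let dominated_near_le (u v : nat -> T -> R) (u0 v0 : T -> R) (U : R) :
  (forall k, measurable_fun setT (u k)) -> (forall k, measurable_fun setT (v k)) ->
  measurable_fun setT u0 -> measurable_fun setT v0 ->
  (forall k x, 0 <= v k x)%R -> (forall k x, 0 <= u k x)%R ->
  (forall x, 0 <= v0 x <= u0 x)%R ->
  (\forall k \near \oo, forall x, v k x <= u k x)%R ->
  {ae mu, forall x, u k x @[k --> \oo] --> u0 x} ->
  {ae mu, forall x, v k x @[k --> \oo] --> v0 x} ->
  \int[mu]_x (u0 x)%:E = U%:E ->
  \int[mu]_x (u k x)%:E @[k --> \oo] --> U%:E ->
  \int[mu]_x (v k x)%:E @[k --> \oo] --> \int[mu]_x (v0 x)%:E.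
Proof.
move=> mu_ mv mu0 mv0 vge0 uge0 vu0 [N _ vu] uu0 vv0 u0U uU.
have v00 x : (0 <= v0 x)%R by have /andP[] := vu0 x.
have uv0 x : (0 <= u0 x - v0 x)%R by rewrite subr_ge0; have /andP[] := vu0 x.
have muv0 : measurable_fun setT (fun x => u0 x - v0 x)%R by exact: measurable_funB.
have UE : \int[mu]_x (v0 x)%:E + \int[mu]_x (u0 x - v0 x)%R%:E = U%:E.
  rewrite -u0U -ge0_integralD//.
  - by apply: eq_integral => x _; rewrite -EFinD addrC subrK.
  - by move=> x _; rewrite lee_fin.
  - exact/measurable_EFinP.
  - by move=> x _; rewrite lee_fin.
  - exact/measurable_EFinP.
have [A AE] : exists A, \int[mu]_x (v0 x)%:E = A%:E.
  have : \int[mu]_x (v0 x)%:E + \int[mu]_x (u0 x - v0 x)%R%:E \is a fin_num.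
    by rewrite UE.
  by rewrite fin_numD => /andP[/EFin_fin_numP].
have [B BE] : exists B, \int[mu]_x (u0 x - v0 x)%R%:E = B%:E.
  have : \int[mu]_x (v0 x)%:E + \int[mu]_x (u0 x - v0 x)%R%:E \is a fin_num.
    by rewrite UE.
  by rewrite fin_numD => /andP[_ /EFin_fin_numP].
(* After the shift by [N] the domination holds for every index, so that the differences [u - v] are
   nonnegative throughout, as Fatou's lemma asks. *)
rewrite AE -(cvg_shiftn N).
have vNu k x : (v (k + N)%N x <= u (k + N)%N x)%R by apply: vu; rewrite /= leq_addl.
have muv k : measurable_fun setT (fun x => u (k + N)%N x - v (k + N)%N x)%R.
  exact: measurable_funB.
have cvg_shift (w : nat -> T -> R) (w0 : T -> R) :
    {ae mu, forall x, w k x @[k --> \oo] --> w0 x} ->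
    {ae mu, forall x, w (k + N)%N x @[k --> \oo] --> w0 x}.
  by apply: filterS => x; rewrite -(cvg_shiftn N (fun k => w k x)).
apply: (@cvge_summand _ (fun k => \int[mu]_x (u (k + N)%N x - v (k + N)%N x)%R%:E) A B).
- by apply: fatou_near AE => //; exact: cvg_shift.
- apply: fatou_near BE => // [k x|]; first by rewrite subr_ge0.
  move: (cvg_shift _ _ uu0) (cvg_shift _ _ vv0).
  by apply: filterS2 => x ux vx; exact: cvgB ux vx.
- rewrite EFinD -AE -BE UE; move: uU; rewrite -(cvg_shiftn N) /=.
  apply: cvg_trans; apply: near_eq_cvg; apply: nearW => k /=.
  rewrite -ge0_integralD//.
  - by apply: eq_integral => x _; rewrite -EFinD addrC subrK.
  - by move=> x _; rewrite lee_fin.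
  - exact/measurable_EFinP.
  - by move=> x _; rewrite lee_fin subr_ge0.
  - exact/measurable_EFinP.
Qed.

(** The domination passes to the limits almost everywhere, so [v0] may be replaced by its minimum
    with [u0], which is below [u0] at every point. *)
Lemma dominated_near (u v : nat -> T -> R) (u0 v0 : T -> R) (U : R) :
  (forall k, measurable_fun setT (u k)) -> (forall k, measurable_fun setT (v k)) ->
  measurable_fun setT u0 -> measurable_fun setT v0 ->
  (forall k x, 0 <= v k x)%R -> (forall k x, 0 <= u k x)%R ->
  (forall x, 0 <= v0 x)%R -> (forall x, 0 <= u0 x)%R ->
  (\forall k \near \oo, forall x, v k x <= u k x)%R ->
  {ae mu, forall x, u k x @[k --> \oo] --> u0 x} ->
  {ae mu, forall x, v k x @[k --> \oo] --> v0 x} ->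
  \int[mu]_x (u0 x)%:E = U%:E ->
  \int[mu]_x (u k x)%:E @[k --> \oo] --> U%:E ->
  \int[mu]_x (v k x)%:E @[k --> \oo] --> \int[mu]_x (v0 x)%:E.
Proof.
move=> mu_ mv mu0 mv0 vge0 uge0 v0ge0 u0ge0 vu uu0 vv0 u0U uU.
have v0u0 : {ae mu, forall x, v0 x = Num.min (v0 x) (u0 x)}.
  move: uu0 vv0; apply: filterS2 => x ux vx; apply/esym/min_idPl.
  by apply: ler_cvg_to vx ux _; apply: filterS vu => k; exact.
have mmin : measurable_fun setT (fun x => Num.min (v0 x) (u0 x)).
  exact: measurable_minr.
have -> : \int[mu]_x (v0 x)%:E = \int[mu]_x (Num.min (v0 x) (u0 x))%:E.
  apply: ge0_ae_eq_integral => //.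
  - exact/measurable_EFinP.
  - exact/measurable_EFinP.
  - by move=> x _; rewrite lee_fin.
  - by move=> x _; rewrite lee_fin le_min v0ge0 u0ge0.
  - by apply: filterS v0u0 => x xE _; congr EFin.
apply: dominated_near_le u0U uU => //.
- by move=> x; rewrite le_min v0ge0 u0ge0 ge_min lexx orbT.
- by move: v0u0 vv0; apply: filterS2 => x <-.
Qed.

End limits_of_integrals.

(** * Convolution powers of a Borel function *)

Section convolution_powers.
Context {R : realType} {d : nat}.
Local Notation mu := (@lebesgue_rV R d).
Variable f : 'rV[R]_d -> R.
Hypothesis mf : measurable_fun setT f.
Hypothesis f0 : forall x, 0 <= f x.
Local Open Scope ereal_scope.

Lemma conv_succ_ge0 n x : 0 <= conv_succ f n x.
Proof.
elim: n x => [|n IH] x /=; first by rewrite lee_fin.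
by apply: integral_ge0 => y _; rewrite mule_ge0// lee_fin.
Qed.

Lemma measurable_conv_integrand (q : 'rV[R]_d -> \bar R) :
  measurable_fun setT q ->
  measurable_fun setT (fun p : 'rV[R]_d * 'rV[R]_d => q (p.1 - p.2)%R * (f p.2)%:E).
Proof.
move=> mq; apply: emeasurable_funM.
  apply: measurableT_comp mq _.
  exact: measurable_funB_rV measurable_fst measurable_snd.
apply/measurable_EFinP; exact: measurableT_comp mf measurable_snd.
Qed.

Lemma measurable_conv_succ n : measurable_fun setT (conv_succ f n).
Proof.
elim: n => [|n IH]; first exact/measurable_EFinP.
have := @measurable_fun_fubini_tonelli_F _ _ _ _ _ mu
  (fun p : 'rV[R]_d * 'rV[R]_d => conv_succ f n (p.1 - p.2)%R * (f p.2)%:E).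
apply; first exact: measurable_conv_integrand.
by move=> p; rewrite mule_ge0 ?conv_succ_ge0// lee_fin.
Qed.

Lemma measurable_expR_dot (theta : 'rV[R]_d) (gamma : R) :
  measurable_fun setT (fun x => expR (gamma * dot theta x)).
Proof.
apply: measurableT_comp; first exact: measurable_expR.
by apply: measurable_funM; [exact: measurable_cst|exact: measurable_dot].
Qed.

(** The exponential weight is multiplicative, e(x + y) = e(x) e(y), so by Tonelli and a translation
    each convolution with [f] multiplies the weighted integral by h. The identity holds in the
    extended reals. *)
Lemma integral_expR_conv_succ (theta : 'rV[R]_d) (gamma : R) n :
  \int[mu]_x ((expR (gamma * dot theta x))%:E * conv_succ f n x) =
  hfun f theta gamma ^+ n.+1.
Proof.
pose e x := expR (gamma * dot theta x).
have e0 x : (0 <= e x)%R by exact: expR_ge0.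
have me : measurable_fun setT e by exact: measurable_expR_dot.
have eD x y : e (x + y)%R = (e x * e y)%R by rewrite /e dotDr mulrDr expRD.
have h0 : 0 <= hfun f theta gamma.
  by apply: integral_ge0 => x _; rewrite lee_fin mulr_ge0// expR_ge0.
elim: n => [|n IH].
  by rewrite expeS expe0 mule1; apply: eq_integral => x _; rewrite -EFinM.
rewrite expeS -IH [LHS](_ : _ = \int[mu]_x \int[mu]_y
    ((e x)%:E * (conv_succ f n (x - y)%R * (f y)%:E))); last first.
  apply: eq_integral => x _ /=; rewrite ge0_integralZl//.
  - apply: emeasurable_funM; last exact/measurable_EFinP.
    apply: measurableT_comp (measurable_conv_succ n) _.
    exact: measurable_subl_rV.
  - by move=> y _; rewrite mule_ge0 ?conv_succ_ge0// lee_fin.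
  - by rewrite lee_fin.
rewrite (@fubini_tonelli _ _ _ _ _ mu mu
  (fun p : 'rV[R]_d * 'rV[R]_d => (e p.1)%:E * (conv_succ f n (p.1 - p.2)%R * (f p.2)%:E))); last 2 first.
- apply: emeasurable_funM; last exact: measurable_conv_integrand (measurable_conv_succ n).
  by apply/measurable_EFinP; exact: measurableT_comp me measurable_fst.
- by move=> p; rewrite !mule_ge0 ?conv_succ_ge0// lee_fin.
rewrite /hfun -ge0_integralZr//; last 3 first.
- apply/measurable_EFinP; apply: measurable_funM => //.
- by move=> x _; rewrite lee_fin mulr_ge0.
- by apply: integral_ge0 => x _; rewrite mule_ge0 ?conv_succ_ge0// lee_fin.
apply: eq_integral => y _ /=.
rewrite -(integral_translation (@lebesgue_rV_translation R d) y); last 2 first.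
- apply: emeasurable_funM; first exact/measurable_EFinP.
  apply: emeasurable_funM; last exact: measurable_cst.
  exact: measurableT_comp (measurable_conv_succ n) (measurable_subr_rV _).
- by move=> x; rewrite !mule_ge0 ?conv_succ_ge0// lee_fin.
rewrite -ge0_integralZl//; last 3 first.
- apply: emeasurable_funM; [exact/measurable_EFinP|exact: measurable_conv_succ].
- by move=> x _; rewrite mule_ge0 ?conv_succ_ge0// lee_fin.
- by rewrite lee_fin mulr_ge0.
apply: eq_integral => x _; rewrite addrK eD !EFinM -!muleA; rewrite muleCA.
by congr (_ * _); rewrite [conv_succ f n x * _]muleC muleCA.
Qed.

(** Substituting S y for y in each convolution integral, each of the n + 1 factors [f] costs one
    factor [K]. *)
Lemma conv_succ_reflection (K : R) (S : 'rV[R]_d -> 'rV[R]_d) n x :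
  (0 <= K)%R -> measurable_fun setT S -> {morph S : x y / (x - y)%R} ->
  (forall A, measurable A -> mu (S @^-1` A) = mu A) ->
  (forall y, f (S y) <= K * f y)%R ->
  conv_succ f n (S x) <= (K ^+ n.+1)%:E * conv_succ f n x.
Proof.
move=> K0 mS SB Smu fS; elim: n x => [|n IH] x.
  by rewrite expr1 -EFinM lee_fin.
have mg y : measurable_fun setT (fun z : 'rV[R]_d => conv_succ f n (y - z)%R * (f z)%:E).
  apply: emeasurable_funM; last exact/measurable_EFinP.
  exact: measurableT_comp (measurable_conv_succ n) (measurable_subl_rV _).
have g0 y z : 0 <= conv_succ f n (y - z)%R * (f z)%:E.
  by rewrite mule_ge0 ?conv_succ_ge0// lee_fin.
rewrite /= -ge0_integralZl//; last by rewrite lee_fin exprn_ge0.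
rewrite -(ge0_integral_invariant mS Smu (mg _) (g0 _)).
apply: ge0_le_integral => //.
- exact: measurableT_comp (mg _) mS.
- by apply: emeasurable_funM; [exact: measurable_cst|exact: mg].
move=> y _; rewrite -SB exprSr EFinM.
rewrite [leRHS](_ : _ = ((K ^+ n.+1)%:E * conv_succ f n (x - y)%R) * (K * f y)%:E).
  by apply: lee_pmul; rewrite ?conv_succ_ge0 ?lee_fin.
by rewrite EFinM -!muleA; congr (_ * _); rewrite muleCA.
Qed.

Hypothesis f_int : \int[mu]_x (f x)%:E < +oo.

Lemma integral_conv_succ_lty n : \int[mu]_x conv_succ f n x < +oo.
Proof.
(* With zero exponent the weight is 1, so the total mass of a convolution power is a power of the
   mass of [f]. *)
have := integral_expR_conv_succ 0%R 0%R n.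
under eq_integral do rewrite mul0r expR0 mul1e.
move=> ->; rewrite /hfun.
under eq_integral do rewrite mul0r expR0 mul1r.
move: f_int; case E : (\int[mu]_x (f x)%:E) => [r| |]// _.
  by rewrite -EFin_expe ltry.
have : 0 <= \int[mu]_x (f x)%:E by apply: integral_ge0 => x _; rewrite lee_fin.
by rewrite E.
Qed.

(** A convolution power may be infinite at some points; there [fine] gives 0. For integrable [f]
    these points form a null set, so further convolutions do not see the change. *)
Definition fine_conv n (x : 'rV[R]_d) : R := fine (conv_succ f n x).

Lemma fine_conv_ge0 n x : (0 <= fine_conv n x)%R.
Proof. by rewrite /fine_conv fine_ge0// conv_succ_ge0. Qed.

Lemma measurable_fine_conv n : measurable_fun setT (fine_conv n).
Proof.
exact: (measurableT_comp (fine_measurable measurableT) (measurable_conv_succ n)).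
Qed.

Lemma ae_conv_succ_fine n :
  {ae mu, forall x, conv_succ f n x = (fine_conv n x)%:E}.
Proof.
have : mu.-integrable setT (conv_succ f n).
  apply/integrableP; split; first exact: measurable_conv_succ.
  rewrite (eq_integral (conv_succ f n)) ?integral_conv_succ_lty// => x _.
  by rewrite gee0_abs ?conv_succ_ge0.
move=> /(integrable_ae measurableT); apply: filterS => x /(_ I) xfin.
by rewrite /fine_conv fineK.
Qed.

Lemma conv_succS_fine n x :
  conv_succ f n.+1 x = \int[mu]_y (fine_conv n (x - y) * f y)%:E.
Proof.
apply: ge0_ae_eq_integral => //.
- apply: emeasurable_funM; last exact/measurable_EFinP.
  exact: measurableT_comp (measurable_conv_succ n) (measurable_subl_rV _).
- apply/measurable_EFinP; apply: measurable_funM => //.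
  exact: measurableT_comp (measurable_fine_conv n) (measurable_subl_rV _).
- by move=> y _; rewrite mule_ge0 ?conv_succ_ge0// lee_fin.
- by move=> y _; rewrite lee_fin mulr_ge0// fine_conv_ge0.
have := ae_comp_invariant (measurable_subl_rV x) (@lebesgue_rV_subl _ _ x)
  (ae_conv_succ_fine n).
apply: filterS => y /= yE _.
by rewrite -[LHS]/(conv_succ f n (x - y)%R * (f y)%:E) yE -EFinM.
Qed.

Lemma conv_div n x (c : R) : (0 < c)%R ->
  conv_succ f n.+1 x / c%:E = \int[mu]_y (fine_conv n (x - y) * f y / c)%:E.
Proof.
move=> c0; rewrite conv_succS_fine inver gt_eqF// -ge0_integralZr//.
- apply/measurable_EFinP; apply: measurable_funM => //.
  exact: measurableT_comp (measurable_fine_conv n) (measurable_subl_rV _).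
- by move=> y _; rewrite lee_fin mulr_ge0// fine_conv_ge0.
- by rewrite lee_fin invr_ge0 ltW.
Qed.

Lemma integral_expR_fine_conv (theta : 'rV[R]_d) (gamma : R) n :
  \int[mu]_x (expR (gamma * dot theta x) * fine_conv n x)%:E =
  hfun f theta gamma ^+ n.+1.
Proof.
rewrite -integral_expR_conv_succ; apply: ge0_ae_eq_integral => //.
- apply/measurable_EFinP; apply: measurable_funM.
    exact: measurable_expR_dot.
  exact: measurable_fine_conv.
- apply: emeasurable_funM; last exact: measurable_conv_succ.
  by apply/measurable_EFinP; exact: measurable_expR_dot.
- by move=> x _; rewrite lee_fin mulr_ge0 ?expR_ge0 ?fine_conv_ge0.
- by move=> x _; rewrite mule_ge0 ?conv_succ_ge0// lee_fin expR_ge0.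
- by apply: filterS (ae_conv_succ_fine n) => x -> _; rewrite EFinM.
Qed.

Lemma integral_fine_conv_lty n : \int[mu]_x (fine_conv n x)%:E < +oo.
Proof.
rewrite (_ : \int[mu]_x _ = \int[mu]_x conv_succ f n x).
  exact: integral_conv_succ_lty.
apply: ge0_ae_eq_integral => //.
- by apply/measurable_EFinP; exact: measurable_fine_conv.
- exact: measurable_conv_succ.
- by move=> x _; rewrite lee_fin fine_conv_ge0.
- by move=> x _; exact: conv_succ_ge0.
- by apply: filterS (ae_conv_succ_fine n) => x ->.
Qed.

End convolution_powers.

(** * Comparison of values under shifts *)

Section asymptotics.
Context {R : realType} {d : nat}.
Local Notation mu := (@lebesgue_rV R d).
(** [fb] is a Borel function almost everywhere equal to [f] and comparable with it through the
    Euclidean norm. The integrals are those of [fb]; the denominators keep [f], whose pointwise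
    values are what [hlim] controls. *)
Variables (f fb : 'rV[R]_d -> R) (K gamma h : R) (theta : 'rV[R]_d).
Hypothesis mfb : measurable_fun setT fb.
Hypothesis fb0 : forall x, 0 <= fb x.
Hypothesis f0 : forall x, 0 <= f x.
Hypothesis ffb : {ae mu, forall x, f x = fb x}.
Hypothesis K0 : 0 < K.
Hypothesis decr : forall x y, 0 < enorm y <= enorm x ->
  [/\ f x <= K * f y, f x <= K * fb y, fb x <= K * f y & fb x <= K * fb y].
Hypothesis radial : forall x y, enorm x = enorm y -> fb x <= K * fb y.
Hypothesis theta1 : enorm theta = 1.
Hypothesis fpos : forall t, 0 < t -> 0 < f (t *: theta).
Hypothesis hlim : directional_limit f theta gamma.
Hypothesis fb_int : (\int[mu]_x (fb x)%:E < +oo)%E.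
Hypothesis hE : hfun fb theta gamma = h%:E.

Let dot_theta x : dot theta x <= enorm x.
Proof. by have := dot_le_enorm theta x; rewrite theta1 mul1r. Qed.

Let enorm_ray t : 0 <= t -> enorm (t *: theta) = t.
Proof. by move=> t0; rewrite enormZ theta1 mulr1 ger0_norm. Qed.

Let dot_ray t : dot theta (t *: theta) = t.
Proof. by rewrite dotZr -enorm_sqr theta1 expr1n mulr1. Qed.

(** This is the directional limit at y = r theta: a convergent ratio is eventually below its limit
    plus one. *)
Lemma ray_shift r : exists C T, [/\ 0 <= C, 0 < T &
  forall t, T <= t -> f ((t - r) *: theta) <= C * f (t *: theta)].
Proof.
pose l := expR (gamma * dot theta (r *: theta)).
have : \forall t \near +oo, f (t *: theta - r *: theta) / f (t *: theta) < l + 1.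
  by apply: (cvgr_lt _ (@hlim (r *: theta))); rewrite ltrDl.
move=> [T [Treal HT]].
exists (l + 1), (Num.max 1 (T + 1)); split.
- by rewrite addr_ge0// expR_ge0.
- by rewrite lt_max ltr01.
- move=> t; rewrite ge_max => /andP[t1 tT].
  have t0 : 0 < t by rewrite (lt_le_trans _ t1).
  have /ltW := HT t (lt_le_trans (ltr_pwDr ltr01 (lexx T)) tT).
  by rewrite ler_pdivrMr ?fpos// scalerBl.
Qed.

(** Almost monotonicity compares w - z with the point of the ray at distance |w| - |z|; [ray_shift]
    moves that point out to distance |w|, and a second comparison returns to w. Each comparison
    costs a factor [K]. *)
Lemma fb_shift z : exists C T, [/\ 0 <= C, 0 < T &
  forall w, T <= enorm w -> fb (w - z) <= C * fb w].
Proof.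
have [C [T [C0 T0 HC]]] := ray_shift (enorm z).
have z0 := enorm_ge0 z.
exists (K * C * K), (T + enorm z); split.
- by rewrite !mulr_ge0// ltW.
- by rewrite ltr_wpDr.
move=> w Tw; set s := enorm w.
have sz : 0 < s - enorm z by rewrite subr_gt0 (lt_le_trans _ Tw)// ltrDr.
have s0 : 0 < s by rewrite (lt_le_trans sz)// gerBl.
have [|_ _ + _] := @decr (w - z) ((s - enorm z) *: theta).
  by rewrite enorm_ray ?(ltW sz)// sz ler_enormB.
move=> /le_trans; apply.
have [|_ + _ _] := @decr (s *: theta) w.
  by rewrite enorm_ray ?(ltW s0)// s0 lexx.
move=> fs; rewrite -!mulrA ler_pM2l//.
apply: le_trans (HC s _) _; first by rewrite (le_trans _ Tw)// lerDl.
by rewrite ler_wpM2l.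
Qed.

(** The point t theta - y has norm at least t - M, so almost monotonicity reduces the bound to a
    shift by M along the ray, uniformly in y. *)
Lemma fb_near_ray M : 0 <= M -> exists C T, [/\ 0 <= C, 0 < T &
  forall t y, T <= t -> enorm y <= M -> fb (t *: theta - y) <= C * f (t *: theta)].
Proof.
move=> M0; have [C [T [C0 T0 HC]]] := ray_shift M.
exists (K * C), (T + M); split; [by rewrite mulr_ge0// ltW|by rewrite ltr_wpDr|].
move=> t y Tt yM.
have tM : 0 < t - M by rewrite subr_gt0 (lt_le_trans _ Tt)// ltrDr.
have t0 : 0 < t by rewrite (lt_le_trans tM)// gerBl.
have [|_ _ + _] := @decr (t *: theta - y) ((t - M) *: theta).
  rewrite enorm_ray ?(ltW tM)// tM (le_trans _ (ler_enormB _ _))//.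
  by rewrite enorm_ray ?(ltW t0)// lerB.
move=> /le_trans; apply; rewrite -mulrA ler_pM2l//.
by rewrite HC// (le_trans _ Tt)// lerDl.
Qed.

(** * Convergence along a sequence of points of the ray *)

Section sequence.
Variable t : nat -> R.
Hypothesis t_oo : t k @[k --> \oo] --> +oo.

Let t_ge (A : R) : \forall k \near \oo, A <= t k.
Proof. by move: A; exact/cvgryPge. Qed.

(** The offset [b] leaves room for a fixed shift z: the image of the complement under
    [y |-> t theta - z - y] is again contained in such a half-space, with another offset. *)
Let half b k : set 'rV[R]_d := [set y | dot theta y <= t k / 2 + b].

Let measurable_half b k : measurable (half b k).
Proof.
rewrite -[X in measurable X]setTI.
exact: (measurable_fun_le measurableT (measurable_dot theta)).
Qed.

Let half_near b y : \forall k \near \oo, half b k y.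
Proof.
near=> k; rewrite /half /= -lerBlDr ler_pdivlMr//.
by near: k; exact: t_ge.
Unshelve. all: by end_near. Qed.

Let a k y : R := fb (t k *: theta - y) * fb y / f (t k *: theta).

Let a_ge0 k y : 0 <= a k y.
Proof. by rewrite divr_ge0// mulr_ge0. Qed.

Let measurable_a k : measurable_fun setT (a k).
Proof.
apply: measurable_funM; last exact: measurable_cst.
apply: measurable_funM => //.
exact: measurableT_comp mfb (measurable_subl_rV _).
Qed.

(** For each k, the y at which [f] and [fb] differ at t_k theta - z - y form a null set. Along a
    sequence there are countably many such sets, so one null set serves all k. *)
Lemma ae_ratio_fb z : {ae mu, forall y,
  fb (t k *: theta - z - y) / f (t k *: theta) @[k --> \oo] -->
  expR (gamma * dot theta (z + y))}.
Proof.
have : {ae mu, forall y, forall k, f (t k *: theta - z - y) = fb (t k *: theta - z - y)}.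
  apply: ae_foralln => k.
  exact: (ae_comp_invariant (measurable_subl_rV _) (@lebesgue_rV_subl _ _ _) ffb).
apply: filterS => y yE.
under eq_fun do rewrite -yE -addrA -opprD.
exact: (cvg_comp _ _ t_oo (@hlim (z + y))).
Qed.

Hypothesis h2 : (conv_succ fb 1 (t k *: theta) / (f (t k *: theta))%:E)%E
  @[k --> \oo] --> (2%:E * h%:E)%E.

Local Open Scope ereal_scope.

Let fatou_a (E : nat -> set 'rV[R]_d) (e : R) :
  (forall k, measurable (E k)) -> (forall y, \forall k \near \oo, E k y) ->
  (0 < e)%R -> \forall k \near \oo, (h - e)%:E < \int[mu]_y (\1_(E k) y * a k y)%:E.
Proof.
move=> mE E_near.
apply: (fatou_near (v0 := fun y => expR (gamma * dot theta y) * fb y)%R).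
- by move=> k; apply: measurable_funM => //; exact: measurable_indic.
- by apply: measurable_funM => //; exact: measurable_expR_dot.
- by move=> k y; rewrite mulr_ge0.
- by move=> y; rewrite mulr_ge0// expR_ge0.
- move: (ae_ratio_fb 0%R); apply: filterS => y; rewrite add0r.
  under eq_fun do rewrite subr0.
  move=> H; apply: cvg_trans (cvgM H (cvg_cst (fb y))); apply: near_eq_cvg.
  near=> k; have Eky : E k y by near: k; exact: E_near.
  by rewrite /= indicE mem_set// mul1r /a /cst mulrAC.
- exact: hE.
Unshelve. all: by end_near. Qed.

(* The map [y |-> t theta - y] sends the complement of [half b k] to a half-space
   of the same kind, with [- b] for [b], so each of the two contributes at least
   [h]. *)
Lemma half_space_cvg b :
  \int[mu]_y (\1_(half b k) y * a k y)%:E @[k --> \oo] --> h%:E.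
Proof.
pose E k : set 'rV[R]_d := [set y | ~ half b k (t k *: theta - y)%R].
have mE k : measurable (E k).
  rewrite -[X in measurable X]setTI.
  exact: (measurable_subl_rV (t k *: theta)%R measurableT
    (measurableC (@measurable_half b k))).
have ma (F : set 'rV[R]_d) k : measurable F ->
    measurable_fun setT (fun y => (\1_F y * a k y)%:E).
  move=> mF; apply/measurable_EFinP.
  exact: (measurable_funM (measurable_indic mF) (@measurable_a k)).
have age0 (F : set 'rV[R]_d) k y : 0 <= (\1_F y * a k y)%:E.
  by rewrite lee_fin mulr_ge0.
(* The integrand [a k] is symmetric under [y |-> t theta - y], so the mass on the complement of the
   half-space is the mass on its image [E k], whose indicator tends to 1 pointwise. *)
have aE k : \int[mu]_y (\1_(~` half b k) y * a k y)%:E =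
    \int[mu]_y (\1_(E k) y * a k y)%:E.
  rewrite -(ge0_integral_invariant (measurable_subl_rV (t k *: theta)%R)
    (@lebesgue_rV_subl _ _ _)) => //; last first.
    by apply: ma; apply: measurableC; exact: (@measurable_half b _).
  apply: eq_integral => y _; congr (_%:E).
  by rewrite /a subKr [(fb y * _)%R]mulrC.
apply: (cvge_summand (b := fun k => \int[mu]_y (\1_(~` half b k) y * a k y)%:E) (B := h)).
- by move=> e; apply: fatou_a; [move=> k; exact: (@measurable_half b _)|exact: half_near].
- move=> e e0; under eq_near do rewrite aE.
  apply: fatou_a => // y; near=> k; rewrite /E /half /= dotBr dot_ray.
  apply/negP; rewrite -ltNge.
  have : (2 * (dot theta y + b) + 1 <= t k)%R by near: k; exact: t_ge.
  lra.
have -> : (h + h)%:E = 2%:E * h%:E by rewrite -EFinM mulr_natl mulr2n.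
apply: cvg_trans h2; apply: near_eq_cvg; near=> k.
have tk0 : (0 < f (t k *: theta))%R.
  by apply: fpos; rewrite (lt_le_trans ltr01)//; near: k; exact: t_ge.
rewrite (conv_div mfb fb0 fb_int)// -ge0_integralD//.
- apply: eq_integral => y _; rewrite -EFinD -mulrDl !indicE in_setC.
  by case: (y \in _); rewrite ?addr0 ?add0r mul1r.
- by apply: ma; exact: (@measurable_half b _).
- by apply: ma; apply: measurableC; exact: (@measurable_half b _).
Unshelve. all: by end_near. Qed.

(* On [E k] the point [t theta - z - y] is far away. Where [y] is far away too,
   the integrand is bounded by a multiple of that of [half_space_cvg]; where [y]
   is bounded, it is bounded by a multiple of [q y]. *)
Section general.
Variables (r q : 'rV[R]_d -> R) (rho C T b : R) (z : 'rV[R]_d).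
Variable E : nat -> set 'rV[R]_d.
Hypothesis (mr : measurable_fun setT r) (mq : measurable_fun setT q).
Hypothesis (r0 : forall x, (0 <= r x)%R) (q0 : forall x, (0 <= q x)%R).
Hypothesis rho0 : (0 <= rho)%R.
Hypothesis C0 : (0 <= C)%R.
Hypothesis rC : forall x, (T <= enorm x -> r x <= C * fb x)%R.
Hypothesis qC : forall x, (T <= enorm x -> q x <= C * fb x)%R.
Hypothesis q_int : \int[mu]_x (q x)%:E < +oo.
Hypothesis rlim : {ae mu, forall y,
  (r (t k *: theta - z - y) / f (t k *: theta))%R @[k --> \oo] -->
  (rho * expR (gamma * dot theta (z + y)))%R}.
Hypothesis mE : forall k, measurable (E k).
Hypothesis E_near : forall y, \forall k \near \oo, E k y.
Hypothesis E_half : forall k, E k `<=` half b k.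

Lemma half_space_conv_cvg :
  \int[mu]_y (\1_(E k) y * (r (t k *: theta - z - y) * q y / f (t k *: theta)))%:E
    @[k --> \oo] -->
  \int[mu]_y (rho * expR (gamma * dot theta (z + y)) * q y)%:E.
Proof.
have [C1 [T1 [C10 T10 shiftP]]] := fb_shift z.
pose M := Num.max T 0%R.
have [C2 [T2 [C20 T20 nearP]]] : exists C2 T2, [/\ (0 <= C2)%R, (0 < T2)%R &
    forall s y, (T2 <= s -> enorm y <= M ->
      fb (s *: theta - y) <= C2 * f (s *: theta))%R].
  by apply: fb_near_ray; rewrite /M le_max lexx orbT.
(* Bounding r costs [C] and undoing the shift by z costs [C1]. The last factor bounds q by [fb] when
   y is far away, or [fb] at t theta - y by [f] at t theta when y is bounded. *)
pose g1 := (C * C1 * C)%R; pose g2 := (C * C1 * C2)%R.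
have g10 : (0 <= g1)%R by rewrite !mulr_ge0.
have g20 : (0 <= g2)%R by rewrite !mulr_ge0.
pose v0 y := (rho * expR (gamma * dot theta (z + y)) * q y)%R.
(* The dominating sequence: the integral of its first term converges by [half_space_cvg], and its
   second term is integrable and independent of k. *)
pose u k y := (g1 * (\1_(half b k) y * a k y) + g2 * q y)%R.
pose u0 y := (g1 * (expR (gamma * dot theta y) * fb y) + g2 * q y)%R.
have mhalf k := @measurable_half b k.
have mu_a k : measurable_fun setT (fun y => \1_(half b k) y * a k y)%R.
  exact: (measurable_funM (measurable_indic (mhalf k)) (@measurable_a k)).
have me : measurable_fun setT (fun y => expR (gamma * dot theta y) * fb y)%R.
  exact: (measurable_funM (measurable_expR_dot theta gamma) mfb).
have [Q QE] : exists Q, \int[mu]_x (q x)%:E = Q%:E.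
  by apply/EFin_fin_numP; rewrite ge0_fin_numE//; apply: integral_ge0 => x _; rewrite lee_fin.
have sumE (w : 'rV[R]_d -> R) : measurable_fun setT w -> (forall y, 0 <= w y)%R ->
    \int[mu]_y (g1 * w y + g2 * q y)%:E = g1%:E * \int[mu]_y (w y)%:E + g2%:E * Q%:E.
  move=> mw w0; under eq_integral do rewrite EFinD !EFinM.
  rewrite ge0_integralD//.
  - rewrite !ge0_integralZl ?QE ?lee_fin//.
    + exact/measurable_EFinP.
    + by move=> x _; rewrite lee_fin.
    + exact/measurable_EFinP.
    + by move=> x _; rewrite lee_fin.
  - by move=> y _; rewrite -EFinM lee_fin mulr_ge0.
  - by apply: emeasurable_funM; [exact: measurable_cst|exact/measurable_EFinP].
  - by move=> y _; rewrite -EFinM lee_fin mulr_ge0.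
  - by apply: emeasurable_funM; [exact: measurable_cst|exact/measurable_EFinP].
have cst_funM (c : R) (w : 'rV[R]_d -> R) : measurable_fun setT w ->
    measurable_fun setT (fun y => c * w y)%R.
  by move=> mw; apply: measurable_funM => //; exact: measurable_cst.
apply: (dominated_near (u := u) (u0 := u0) (U := (g1 * h + g2 * Q)%R)).
- by move=> k; apply: measurable_funD; exact: cst_funM.
- move=> k; apply: measurable_funM; first exact: measurable_indic.
  apply: measurable_funM; last exact: measurable_cst.
  apply: measurable_funM => //.
  exact: measurableT_comp mr (measurable_subl_rV _).
- by apply: measurable_funD; exact: cst_funM.
- apply: measurable_funM => //; apply: cst_funM.
  exact: (measurableT_comp (measurable_expR_dot theta gamma)
    (measurable_funD_rV (measurable_cst z) (@measurable_id _ _ setT))).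
- by move=> k y; rewrite mulr_ge0// divr_ge0// mulr_ge0.
- by move=> k y; rewrite addr_ge0// mulr_ge0// mulr_ge0.
- by move=> y; rewrite mulr_ge0// mulr_ge0// expR_ge0.
- by move=> y; rewrite addr_ge0// mulr_ge0// mulr_ge0// expR_ge0.
- near=> k => y.
  have tk : (2 * (Num.max T1 (T + enorm z) + b) <= t k)%R by near: k; exact: t_ge.
  have tk2 : (T2 <= t k)%R by near: k; exact: t_ge.
  have fk : (0 < f (t k *: theta))%R.
    by apply: fpos; rewrite (lt_le_trans T20).
  rewrite /u; have [Ey|Ey] := pselect (E k y); last first.
    by rewrite indicE memNset// mul0r addr_ge0// mulr_ge0// mulr_ge0.
  have hy := E_half Ey; rewrite !indicE !mem_set// !mul1r.
  (* On the half-space |t theta - y| >= t - theta.y >= t/2 - b. The bound [T1] serves the shift by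
     z, and [T + enorm z] keeps t theta - z - y at distance [T]. *)
  have far : (Num.max T1 (T + enorm z) <= enorm (t k *: theta - y))%R.
    apply: le_trans (dot_theta _); rewrite dotBr dot_ray.
    by move: hy tk; rewrite /half /=; lra.
  move: far; rewrite ge_max => /andP[far1 far2].
  have rk : (r (t k *: theta - z - y) <= C * C1 * fb (t k *: theta - y))%R.
    rewrite -addrA [(- z - y)%R]addrC addrA.
    apply: (le_trans (rC _)).
      by apply: le_trans (ler_enormB _ _); rewrite lerBrDr.
    by rewrite -mulrA ler_wpM2l// shiftP.
  have af : (a k y * f (t k *: theta) = fb (t k *: theta - y) * fb y)%R.
    by rewrite /a divfK// gt_eqF.
  rewrite ler_pdivrMr// mulrDl -mulrA af -[(g2 * _ * _)%R]mulrA.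
  have [yT|yT] := leP T (enorm y).
    apply: (@le_trans _ _ (g1 * (fb (t k *: theta - y) * fb y))%R).
      rewrite [leRHS](_ : _ = ((C * C1 * fb (t k *: theta - y)) * (C * fb y)))%R.
        by apply: ler_pM => //; exact: qC.
      by rewrite /g1; ring.
    by rewrite lerDl !mulr_ge0// ltW.
  have nk : (fb (t k *: theta - y) <= C2 * f (t k *: theta))%R.
    by apply: nearP => //; rewrite /M le_max (ltW yT).
  apply: (@le_trans _ _ (g2 * (q y * f (t k *: theta)))%R); last first.
    by rewrite lerDr !mulr_ge0.
  rewrite [leRHS](_ : _ = ((C * C1 * (C2 * f (t k *: theta))) * q y))%R; last first.
    by rewrite /g2; ring.
  by rewrite ler_wpM2r// (le_trans rk)// ler_wpM2l// mulr_ge0.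
- move: (ae_ratio_fb 0%R); apply: filterS => y; rewrite add0r.
  under eq_fun do rewrite subr0.
  move=> H; apply: cvgD; last exact: cvg_cst.
  apply: cvgM; first exact: cvg_cst.
  apply: cvg_trans (cvgM H (cvg_cst (fb y))); apply: near_eq_cvg.
  near=> k; have Hky : half b k y by near: k; exact: half_near.
  by rewrite /= indicE mem_set// mul1r /a /cst mulrAC.
- move: rlim; apply: filterS => y H.
  apply: cvg_trans (cvgM H (cvg_cst (q y))); apply: near_eq_cvg.
  near=> k; have Eky : E k y by near: k; exact: E_near.
  by rewrite /= indicE mem_set// mul1r /cst mulrAC.
- rewrite (sumE (fun y => expR (gamma * dot theta y) * fb y)%R)//; last first.
    by move=> y; rewrite mulr_ge0// expR_ge0.
  rewrite -[X in _ * X + _]/(hfun fb theta gamma) hE.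
  by rewrite -!EFinM -EFinD.
- have ua0 k y : (0 <= \1_(half b k) y * a k y)%R by rewrite mulr_ge0.
  under eq_fun => k do rewrite (sumE _ (mu_a k) (ua0 k)).
  rewrite EFinD (EFinM g1) (EFinM g2); apply: cvgeD => //; last exact: cvg_cst.
  by apply: cvgeZl => //; exact: half_space_cvg.
Unshelve. all: by end_near. Qed.

End general.

End sequence.

Local Open Scope ereal_scope.

Let f_near : \forall t \near +oo%R, (0 < f (t *: theta))%R.
Proof. by exists 0%R; split => // t t0; exact: fpos. Qed.

(** Convolution turns almost everywhere equality into equality at every point, since [y |-> x - y]
    preserves null sets. The integrand built from [f] may fail to be Borel, hence the appeal to
    [ge0_ae_eq_integral_nonmeasurable]. *)
Let conv_succ_eq_step n : {ae mu, forall x, conv_succ f n x = conv_succ fb n x} ->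
  forall x, conv_succ f n.+1 x = conv_succ fb n.+1 x.
Proof.
move=> ffb_n x; apply: ge0_ae_eq_integral_nonmeasurable.
- apply: emeasurable_funM; last exact/measurable_EFinP.
  exact: measurableT_comp (measurable_conv_succ mfb fb0 n) (measurable_subl_rV _).
- by move=> y; rewrite mule_ge0 ?conv_succ_ge0// lee_fin.
- by move=> y; rewrite mule_ge0 ?conv_succ_ge0// lee_fin.
have := ae_comp_invariant (measurable_subl_rV x) (@lebesgue_rV_subl _ _ x) ffb_n.
move: ffb; apply: filterS2 => y fy convy _.
by rewrite -[LHS]/(conv_succ f n (x - y)%R * (f y)%:E) fy convy.
Qed.

Lemma ae_conv_succ_eq n :
  {ae mu, forall x, conv_succ f n x = conv_succ fb n x}.
Proof.
elim: n => [|n IH]; first by apply: filterS ffb => x /= ->.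
by apply: aeW; exact: conv_succ_eq_step.
Qed.

Lemma conv_succS_eq n x : conv_succ f n.+1 x = conv_succ fb n.+1 x.
Proof. exact: conv_succ_eq_step (ae_conv_succ_eq n) x. Qed.

(** * Induction on the number of factors *)

(** The index is that of [conv_succ]: [n] stands for n + 1 factors, whence the constant (n + 1)
    h^n. *)
Definition conv_ratio_limit n := forall y,
  conv_succ f n (t *: theta - y) / (f (t *: theta))%:E @[t --> +oo%R] -->
  (n.+1%:R * h ^+ n * expR (gamma * dot theta y))%:E.

Lemma conv_ratio_limit0 : conv_ratio_limit 0.
Proof.
move=> y; apply/fine_cvgP; rewrite expr0 !mul1r; split.
  by apply: filterS f_near => t ft; rewrite /= inver gt_eqF.
apply: cvg_trans (@hlim y); apply: near_eq_cvg.
by apply: filterS f_near => t ft; rewrite /= inver gt_eqF.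
Qed.

(* The hypothesis only concerns the direction [theta]; a reflection sending
   [|x| theta] to [x] carries it to all directions. *)
Lemma conv_succ_far_bound n : conv_ratio_limit n -> exists C T,
  [/\ (0 <= C)%R, (0 < T)%R &
    forall x, (T <= enorm x)%R -> conv_succ fb n x <= (C * fb x)%:E].
Proof.
(* A single factor is treated apart: the bound is trivial, and [conv_succS_eq] gives pointwise
   equality only from two factors on. *)
case: n => [|n] lim.
  by exists 1%R, 1%R; split => // x _; rewrite mul1r.
have /fine_cvgP[lfin llim] := lim 0%R.
pose l : R := (n.+2%:R * h ^+ n.+1 * expR (gamma * dot theta 0))%R.
have [T [Treal HT]] : \forall t \near +oo%R,
    conv_succ fb n.+1 (t *: theta) <= (`|l + 1| * f (t *: theta))%:E.
  near=> t.
  have ft : (0 < f (t *: theta))%R by near: t; exact: f_near.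
  have : conv_succ f n.+1 (t *: theta - 0) / (f (t *: theta))%:E \is a fin_num.
    by near: t; exact: lfin.
  have : (fine (conv_succ f n.+1 (t *: theta - 0) / (f (t *: theta))%:E) < l + 1)%R.
    by near: t; apply: (cvgr_lt _ llim); rewrite ltrDl.
  rewrite subr0 conv_succS_eq inver gt_eqF//.
  have := conv_succ_ge0 fb0 n.+1 (t *: theta).
  case: (conv_succ fb n.+1 (t *: theta)) => [s| |]//= _.
    rewrite -[X in (X < _)%R]/(s / f (t *: theta))%R => sl _.
    rewrite lee_fin -ler_pdivrMr// (le_trans (ltW sl))//; exact: ler_norm.
  by move=> _; rewrite gt0_mulye ?lte_fin ?invr_gt0.
(* The power of [K] comes from reflecting n + 2 factors, the middle constant from the bound on the
   ray, and the last [K] from comparing [f] at |x| theta with [fb] at x. *)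
exists (K ^+ n.+2 * `|l + 1| * K)%R, (Num.max 1 (T + 1))%R; split.
- have K0' : (0 <= K)%R := ltW K0.
  by rewrite mulr_ge0// mulr_ge0// exprn_ge0.
- by rewrite lt_max ltr01.
move=> x; rewrite ge_max => /andP[x1 xT]; set s := enorm x in x1 xT *.
have s0 : (0 < s)%R by exact: lt_le_trans x1.
have nE : enorm (s *: theta) = enorm x by rewrite enorm_ray// ltW.
rewrite -[in leLHS](reflection_swap nE).
apply: (le_trans (conv_succ_reflection mfb fb0 (K := K) n.+1 (s *: theta) _ _ _ _ _)).
- exact: ltW.
- exact: measurable_reflection.
- exact: reflectionB.
- by move=> A mA; exact: lebesgue_rV_reflection.
- by move=> y; apply: radial; rewrite enorm_reflection.
have K2 : (0 <= K ^+ n.+2)%R by rewrite exprn_ge0// ltW.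
apply: (@le_trans _ _ ((K ^+ n.+2)%:E * (`|l + 1| * f (s *: theta))%:E)).
  by apply: lee_wpmul2l; rewrite ?lee_fin//; apply: HT; rewrite (lt_le_trans _ xT)// ltrDl.
rewrite -EFinM lee_fin; move: (K ^+ n.+2)%R K2 => Kn Kn0.
rewrite -[leRHS]mulrA -[leRHS]mulrA ler_wpM2l// ler_wpM2l//.
by have [|_ ? _ _] := @decr (s *: theta) x; rewrite ?nE ?lexx ?andbT.
Unshelve. all: by end_near. Qed.

Lemma ae_ratio_fine_conv n (t : nat -> R) z : conv_ratio_limit n ->
  t k @[k --> \oo] --> +oo%R -> {ae mu, forall y,
  (fine_conv fb n (t k *: theta - z - y) / f (t k *: theta))%R @[k --> \oo] -->
  (n.+1%:R * h ^+ n * expR (gamma * dot theta (z + y)))%R}.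
Proof.
move=> lim t_oo.
have fineE : {ae mu, forall x, conv_succ f n x = (fine_conv fb n x)%:E}.
  move: (ae_conv_succ_eq n) (ae_conv_succ_fine mfb fb0 fb_int n).
  by apply: filterS2 => x ->.
have : {ae mu, forall y, forall k, conv_succ f n (t k *: theta - z - y) =
    (fine_conv fb n (t k *: theta - z - y))%:E}.
  apply: ae_foralln => k.
  exact: (ae_comp_invariant (measurable_subl_rV _) (@lebesgue_rV_subl _ _ _) fineE).
apply: filterS => y yE.
have /fine_cvgP[_] := cvg_comp _ _ t_oo (lim (z + y)%R).
apply: cvg_trans; apply: near_eq_cvg.
have : \forall k \near \oo, (0 < f (t k *: theta))%R by exact: t_oo f_near.
apply: filterS => k fk.
by rewrite /= opprD addrA yE inver gt_eqF.
Qed.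

Hypothesis h2 : conv_succ f 1 (t *: theta) / (f (t *: theta))%:E @[t --> +oo%R]
  --> 2%:E * h%:E.

Lemma conv_ratio_limitS n : conv_ratio_limit n -> conv_ratio_limit n.+1.
Proof.
(* Testing the limit along sequences makes the almost everywhere convergence of the ratios
   available. *)
move=> lim z; apply/cvge_pinftyP => t t_oo.
have h0 : (0 <= h)%R.
  rewrite -lee_fin -hE; apply: integral_ge0 => y _.
  by rewrite lee_fin mulr_ge0// expR_ge0.
pose rho : R := (n.+1%:R * h ^+ n)%R.
have rho0 : (0 <= rho)%R by rewrite mulr_ge0// exprn_ge0.
pose q := fine_conv fb n.
have mq : measurable_fun setT q := measurable_fine_conv mfb fb0 n.
have q0 x : (0 <= q x)%R := fine_conv_ge0 fb0 n x.
have [C [T [C0 T0 far]]] := conv_succ_far_bound lim.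
have qC x : (T <= enorm x -> q x <= C * fb x)%R.
  move=> /far; rewrite /q /fine_conv.
  have := conv_succ_ge0 fb0 n x.
  by case: (conv_succ fb n x) => //= s _; rewrite lee_fin.
(* The constant C + 1 bounds both [fb] and [q] by multiples of [fb], so that either can play either
   role in [half_space_conv_cvg]. *)
have rC x : (T <= enorm x -> fb x <= (C + 1) * fb x)%R.
  by move=> _; rewrite mulrDl mul1r lerDr mulr_ge0.
have qC1 x : (T <= enorm x -> q x <= (C + 1) * fb x)%R.
  by move=> /qC /le_trans; apply; rewrite mulrDl lerDl mul1r.
have C10 : (0 <= C + 1)%R by rewrite addr_ge0.
have q_int : \int[mu]_x (q x)%:E < +oo := integral_fine_conv_lty mfb fb0 fb_int n.
have h2t : conv_succ fb 1 (t k *: theta) / (f (t k *: theta))%:E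
    @[k --> \oo] --> 2%:E * h%:E.
  apply: cvg_trans (cvg_comp _ _ t_oo h2); apply: near_eq_cvg; apply: nearW => k.
  by rewrite -conv_succS_eq.
pose H k : set 'rV[R]_d := [set y | (dot theta y <= t k / 2 + 0)%R].
have mH k : measurable (H k).
  rewrite -[X in measurable X]setTI.
  exact: (measurable_fun_le measurableT (measurable_dot theta)).
have t_ge A : \forall k \near \oo, (A <= t k)%R by move: A; exact/cvgryPge.
have H_near y : \forall k \near \oo, H k y.
  near=> k; rewrite /H /= addr0 ler_pdivlMr//.
  by near: k; exact: t_ge.
(* The image of the complement of [H k] under [y |-> t theta - z - y], a map that exchanges the
   roles of [q] and [fb] in the integrand. *)
pose E k : set 'rV[R]_d := [set y | (~` H k) (t k *: theta - z - y)%R].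
have mE k : measurable (E k).
  rewrite -[X in measurable X]setTI.
  exact: (measurable_subl_rV _ measurableT (measurableC (mH k))).
have dotE k y : dot theta (t k *: theta - z - y) = (t k - dot theta z - dot theta y)%R.
  by rewrite !dotBr dot_ray.
have E_near y : \forall k \near \oo, E k y.
  near=> k; rewrite /E /H /= dotE addr0; apply/negP; rewrite -ltNge.
  have : (2 * (dot theta z + dot theta y) + 1 <= t k)%R by near: k; exact: t_ge.
  lra.
have E_half k y : E k y -> (dot theta y <= t k / 2 + - dot theta z)%R.
  rewrite /E /H /= dotE addr0 => /negP; rewrite -ltNge; lra.
(* On [H k] the power [q] is evaluated far away and contributes its limiting ratio [rho], while [fb]
   is integrated, giving h. *)
have cvg1 := half_space_conv_cvg t_oo h2t mq mfb q0 fb0 rho0 C10 qC1 rC fb_int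
  (ae_ratio_fine_conv z lim t_oo) mH H_near (fun k y => id).
have fb_lim : {ae mu, forall y, (fb (t k *: theta - z - y) / f (t k *: theta))%R
    @[k --> \oo] --> (1 * expR (gamma * dot theta (z + y)))%R}.
  by move: (ae_ratio_fb t_oo z); apply: filterS => y; rewrite mul1r.
(* On the other half [fb] is evaluated far away, with constant 1, and the weighted integral of [q]
   gives h^(n+1). *)
have cvg2 := half_space_conv_cvg t_oo h2t mfb mq fb0 q0 ler01 C10 rC qC1 q_int
  fb_lim mE E_near E_half.
have intE (c W : R) (w : 'rV[R]_d -> R) : (0 <= c)%R -> measurable_fun setT w ->
    (forall y, 0 <= w y)%R ->
    \int[mu]_y (expR (gamma * dot theta y) * w y)%:E = W%:E ->
    \int[mu]_y (c * expR (gamma * dot theta (z + y)) * w y)%:E =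
    (c * expR (gamma * dot theta z) * W)%:E.
  move=> c0 mw w0 WE; rewrite EFinM -WE -ge0_integralZl//.
  - apply: eq_integral => y _; rewrite -EFinM dotDr mulrDr expRD.
    by congr EFin; ring.
  - apply/measurable_EFinP.
    exact: (measurable_funM (measurable_expR_dot theta gamma) mw).
  - by move=> y _; rewrite lee_fin mulr_ge0// expR_ge0.
  - by rewrite lee_fin mulr_ge0// expR_ge0.
rewrite (intE rho h) ?hE// in cvg1.
rewrite (intE 1%R (h ^+ n.+1)%R)// in cvg2; last first.
  by rewrite integral_expR_fine_conv// hE EFin_expe.
(* The recursion of the constants: (n + 2) h^(n+1) = (n + 1) h^n h + h^(n+1). *)
have -> : (n.+2%:R * h ^+ n.+1 * expR (gamma * dot theta z))%:E =
    (rho * expR (gamma * dot theta z) * h)%:E +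
    (1 * expR (gamma * dot theta z) * h ^+ n.+1)%:E.
  by rewrite -EFinD; congr EFin; rewrite /rho exprSr -[n.+2]addn1 natrD; ring.
apply: cvg_trans (cvgeD _ cvg1 cvg2) => //; apply: near_eq_cvg; near=> k.
have fk : (0 < f (t k *: theta))%R.
  by apply: fpos; rewrite (lt_le_trans ltr01)//; near: k; exact: t_ge.
pose w y := (q (t k *: theta - z - y) * fb y / f (t k *: theta))%R.
have mw : measurable_fun setT w.
  apply: measurable_funM; last exact: measurable_cst.
  apply: measurable_funM => //.
  exact: measurableT_comp mq (measurable_subl_rV _).
have w0 y : (0 <= w y)%R by rewrite divr_ge0// mulr_ge0.
have mHw : measurable_fun setT (fun y => (\1_(~` H k) y * w y)%:E).
  apply/measurable_EFinP.
  exact: (measurable_funM (measurable_indic (measurableC (mH k))) mw).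
have -> : \int[mu]_y
    (\1_(E k) y * (fb (t k *: theta - z - y) * q y / f (t k *: theta)))%:E =
    \int[mu]_y (\1_(~` H k) y * w y)%:E.
  rewrite -(ge0_integral_invariant (measurable_subl_rV (t k *: theta - z)%R)
    (@lebesgue_rV_subl _ _ _) mHw) => [|y]; last by rewrite lee_fin mulr_ge0.
  apply: eq_integral => y _; congr (_%:E).
  by rewrite /w subKr [(q y * _)%R]mulrC.
rewrite conv_succS_eq (conv_div mfb fb0 fb_int)// -ge0_integralD//.
- apply: eq_integral => y _; rewrite -EFinD -mulrDl !indicE in_setC.
  by case: (y \in _); rewrite ?addr0 ?add0r mul1r.
- by move=> y _; rewrite lee_fin mulr_ge0//; exact: w0.
- by apply/measurable_EFinP; exact: (measurable_funM (measurable_indic (mH k)) mw).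
- by move=> y _; rewrite lee_fin mulr_ge0.
Unshelve. all: by end_near. Qed.

End asymptotics.

(** * A comparable Borel representative *)

Section borel_version.
Context {R : realType}.

(** As [g] may blow up at 0, it need not extend to a real-valued monotone function on the line. Its
    reciprocal does, with value 0 on the nonpositive reals, and is inverted through [ln] and
    [expR]. *)
Lemma measurable_nonincreasing_pos (g : R -> R) (a : R) :
  (forall s, 0 < s -> 0 < g s) ->
  (forall s t, 0 < s -> s <= t -> g t <= g s) ->
  measurable_fun setT (fun s : R => if 0 < s then g s else a).
Proof.
move=> g0 gd; pose m s := if 0 < s then (g s)^-1 else 0.
have mm : measurable_fun setT m.
  apply: nondecreasing_measurable => // s t st; rewrite /m.
  case: ifPn => s0.
    by rewrite (lt_le_trans s0 st) lef_pV2 ?posrE ?g0 ?gd// (lt_le_trans s0 st).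
  by case: ifPn => // t0; rewrite invr_ge0 ltW// g0.
rewrite (_ : (fun s : R => _) =
    (fun s : R => if 0 < s then expR (- ln (m s)) else a)); last first.
  apply/funext => s; rewrite /m; case: ifPn => // s0.
  by rewrite lnV ?posrE ?g0// opprK lnK// posrE g0.
apply: measurable_fun_ifT.
- by apply: measurable_fun_ltr => //; exact: measurable_cst.
- have mln : measurable_fun setT (fun s => ln (m s)).
    exact: measurableT_comp (@measurable_ln R) mm.
  exact: measurableT_comp (@measurable_expR R) (measurable_funN mln).
- exact: measurable_cst.
Qed.

Variables (d : nat) (f : 'rV[R]_d -> R).
Local Notation mu := (@lebesgue_rV R d).

(* Truncating an arbitrary Borel representative between the radial bounds makes
   it comparable with [f] everywhere, not only almost everywhere; at the origin,
   where [g] gives no bound, the value [f 0] plays the role of the bound. *)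
Lemma borel_version : in_L1 f -> (forall x, 0 <= f x) ->
  almost_radial_decreasing f ->
  exists (fb : 'rV[R]_d -> R) (K : R), [/\ measurable_fun setT fb,
    forall x, 0 <= fb x, {ae mu, forall x, f x = fb x},
    (\int[mu]_x (fb x)%:E < +oo)%E &
    [/\ 0 < K,
      forall x y, 0 < enorm y <= enorm x ->
        [/\ f x <= K * f y, f x <= K * fb y, fb x <= K * f y & fb x <= K * fb y] &
      forall x y, enorm x = enorm y -> fb x <= K * fb y]].
Proof.
move=> [f1 f1int ff1] f0 [g [c [g0 gd c1 fg]]].
have c0 : 0 < c by exact: lt_le_trans ltr01 c1.
pose G (x : 'rV[R]_d) := if 0 < enorm x then g (enorm x) else f 0.
have mG : measurable_fun setT G.
  exact: measurableT_comp (measurable_nonincreasing_pos (f 0) g0 gd) measurable_enorm.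
have fG x : c^-1 * G x <= f x <= c * G x.
  (* At the origin [G] equals [f 0], and the bounds hold because c >= 1 and f 0 >= 0. *)
  rewrite /G enorm_gt0; case: ifPn => [/fg[-> ->]//|/negbNE/eqP ->].
  by rewrite ler_pdivrMl// !ler_peMl.
have G0 x : 0 <= G x.
  by have /andP[_] := fG x; move=> /(le_trans (f0 x)); rewrite pmulr_rge0.
have lohi x : c^-1 * G x <= c * G x by have /andP[] := fG x; exact: le_trans.
have mf1 : measurable_fun setT f1 by apply/measurable_EFinP; exact: measurable_int f1int.
pose fb (x : 'rV[R]_d) := Num.max (c^-1 * G x) (Num.min (f1 x) (c * G x)).
have fbG x : c^-1 * G x <= fb x <= c * G x.
  by rewrite /fb le_max lexx/= ge_max lohi ge_min lexx orbT.
have mfb : measurable_fun setT fb.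
  apply: measurable_maxr; first exact: measurable_funM (measurable_cst _) mG.
  apply: measurable_minr => //; exact: measurable_funM (measurable_cst _) mG.
have fb0 x : 0 <= fb x.
  by have /andP[+ _] := fbG x; apply: le_trans; rewrite mulr_ge0// invr_ge0 ltW.
have ffb : {ae mu, forall x, f x = fb x}.
  apply: filterS ff1 => x /(_ I) fx; have /andP[lo hi] := fG x.
  by rewrite /fb -fx (min_idPl hi) (max_idPr lo).
(* An upper bound by c G and a lower bound by G / c combine to the factor c^2, which is the constant
   [K]. *)
have cmp (u v : 'rV[R]_d -> R) x y : (u x <= c * G x) -> (c^-1 * G y <= v y) ->
    G x <= G y -> u x <= c ^+ 2 * v y.
  move=> ux vy Gxy; apply: (le_trans ux); rewrite expr2 -mulrA ler_pM2l//.
  by apply: (le_trans Gxy); rewrite -ler_pdivrMl.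
exists fb, (c ^+ 2); split => //; last split.
- rewrite (_ : (\int[mu]_x _ = \int[mu]_x `|(f1 x)%:E|)%E).
    by case/integrableP : f1int.
  apply: ge0_ae_eq_integral => //.
  + exact/measurable_EFinP.
  + by apply: measurableT_comp => //; exact/measurable_EFinP.
  + by move=> x _; rewrite lee_fin.
  + by move: ffb ff1; apply: filterS2 => x fbx /(_ I) fx _; rewrite -fbx -fx abse_EFin ger0_norm.
- by rewrite exprn_gt0.
- move=> x y /andP[y0 yx].
  have Gxy : G x <= G y by rewrite /G y0 (lt_le_trans y0 yx) gd.
  have /andP[_ fx] := fG x; have /andP[_ fbx] := fbG x.
  have /andP[fy _] := fG y; have /andP[fby _] := fbG y.
  by split; exact: cmp.
- move=> x y xy; have /andP[_ fbx] := fbG x; have /andP[fby _] := fbG y.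
  by apply: cmp => //; rewrite /G xy.
Qed.

End borel_version.

(** * The equivalence of the two limit conditions *)

Theorem corollary1p5 (R : realType) (d : nat) (hd : (1 <= d)%N)
  (f : 'rV[R]_d -> R) (hf : density f) (hrad : almost_radial_decreasing f)
  (theta : 'rV[R]_d) (htheta : sphere theta)
  (gamma : R) (hgamma : 0 <= gamma)
  (hlim : directional_limit f theta gamma) :
  classS theta gamma f <->
  (hfun f theta gamma < +oo)%E /\
  forall (y : 'rV[R]_d) (n : nat), (1 <= n)%N ->
    (conv_pow f n (t *: theta - y) / (f (t *: theta))%:E)%E @[t --> +oo]
      --> ((expR (gamma * dot theta y) * n%:R)%:E
             * hfun f theta gamma ^+ n.-1)%E.
Proof.
have [fL1 f0 _] := hf.
have fpos t : 0 < t -> 0 < f (t *: theta).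
  move=> t0; have [g [c [g0 _ c1 fg]]] := hrad.
  have [|+ _] := fg (t *: theta).
    by rewrite -enorm_gt0 enormZ htheta mulr1 normr_gt0 gt_eqF.
  apply: lt_le_trans; rewrite mulr_gt0 ?invr_gt0 ?(lt_le_trans ltr01 c1)// g0//.
  by rewrite enormZ htheta mulr1 normr_gt0 gt_eqF.
(* The converse comes first: the condition on the twofold convolution is the case n = 2, y = 0 of
   the general limit. *)
split=> [[_ _ _ _ [hoo lim2]]|[hoo lim]]; last first.
  split => //.
    by exists 1 => // t t1; apply: fpos; rewrite (lt_le_trans ltr01).
  split => //; have := lim 0 2 isT.
  rewrite dot0r mulr0 expR0 mul1r expeS expe0 mule1.
  by under eq_fun do rewrite subr0.
split=> // y [//|n] _.
(* In the forward direction everything is transferred to a Borel representative; its exponential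
   integral is that of [f], and finiteness gives a real number h. *)
have [fb [K [mfb fb0 ffb fb_int [K0 decr radial]]]] := borel_version fL1 f0 hrad.
have hfb : hfun f theta gamma = hfun fb theta gamma.
  apply: ge0_ae_eq_integral_nonmeasurable.
  - apply/measurable_EFinP.
    exact: (measurable_funM (measurable_expR_dot theta gamma) mfb).
  - by move=> x; rewrite lee_fin mulr_ge0// expR_ge0.
  - by move=> x; rewrite lee_fin mulr_ge0// expR_ge0.
  - by apply: filterS ffb => x -> _.
have [h hE] : exists h, hfun f theta gamma = h%:E.
  apply/EFin_fin_numP; rewrite ge0_fin_numE//; apply: integral_ge0 => x _.
  by rewrite lee_fin mulr_ge0// expR_ge0.
have ratio m : conv_ratio_limit f gamma h theta m.
  elim: m => [|m IH]; first exact: conv_ratio_limit0.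
  apply: (@conv_ratio_limitS _ _ f fb K gamma h theta) => //.
  - by rewrite -hfb.
  - by rewrite -hE.
rewrite hE /= -EFin_expe -EFinM.
rewrite (_ : (_ * h ^+ n)%R = n.+1%:R * h ^+ n * expR (gamma * dot theta y)).
  exact: ratio.
by ring.
Qed.
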